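(* Let $k,n,T\in\mathbb{N}$ be positive integers and $\mathbf{X}=\mathbb{R}^n$. Let $x_0\in\mathbf{X}$, let $\mu$ be the law on $\mathbf{X}^{T+1}$ of an $\mathbf{X}$-valued martingale $(M_0,\dots,M_T)$ with $M_0=x_0$, and let $A\subseteq\mathbf{X}^{T+1}$ be a $\mu$-measurable set with $\mu(A)=1$. Let $f:\mathbf{X}^{T+1}\to\mathbb{R}^k$ be a $\mu$-measurable function with $\mu[|f|]<\infty$. Then there exists a martingale law $\nu$ on $\mathbf{X}^{T+1}$, also starting at $x_0$, such that \[ \#\operatorname{supp}\nu\le(n+k+1)^T,\qquad \operatorname{supp}\nu\subseteq A,\qquad \nu[f]=\mu[f]. \]
   Context: A martingale law on $\mathbf{X}^{T+1}$ starting at $x_0$ is the law of an $\mathbf{X}$-valued martingale $(M_0,\dots,M_T)$ with $M_0=x_0$; equivalently, a Borel probability measure under which the coordinate process is a martingale in its own filtration with initial value $x_0$. ''$\mu$-measurable'' means measurable with respect to the $\mu$-completion of the Borel $\sigma$-field. $\mu[f]=\int f\,d\mu$. *)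

(* Defs.v *)
From HB Require Import structures.
From mathcomp Require Import all_boot all_order all_algebra.
From mathcomp Require Import all_classical all_reals all_analysis.
From mathcomp Require Import measurable_realfun.

Set Implicit Arguments.
Unset Strict Implicit.
Unset Printing Implicit Defensive.

Import Order.TTheory GRing.Theory Num.Theory.
Import numFieldNormedType.Exports.

Local Open Scope classical_set_scope.
Local Open Scope ring_scope.

Definition borel (T : ptopologicalType) := g_sigma_algebraType (@open T).

(* X ^ (T + 1) with X = R ^ n: row t of the matrix is the state at time t. The
   topology of the matrices is the product topology. *)
Definition paths (R : realType) (n T : nat) := borel 'M[R]_(T.+1, n).

Definition coordinate (R : realType) (n T : nat) (t : 'I_T.+1)
  (w : paths R n T) : 'rV[R]_n := row t (w : 'M[R]_(T.+1, n)).

Section completion.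
Context d (T : measurableType d) (R : realType).
Variable mu : {measure set T -> \bar R}.

Definition completion := g_sigma_algebraType (completed_algebra_gen mu).

(* The value of mu^* at A `|` N, with A measurable and N negligible, is mu A. *)
Definition completed_mu_ext : set completion -> \bar R := (mu^*)%mu.

Let sub_caratheodory_completion :
  (completed_algebra_gen mu).-sigma.-measurable `<=`
  (mu^*)%mu.-cara.-measurable.
Proof.
apply: smallest_sub.
  split => [|A mA|F mF]; first exact: measurable0.
  - by rewrite setTD; exact: measurableC.
  - exact: bigcupT_measurable.
move=> _ [A mA [N [B [mB B0 NB]] <-]].
have sub_cara C : d.-measurable C -> (mu^*)%mu.-cara.-measurable C.
  by move=> mC; apply: sub_caratheodory; exact: sub_sigma_algebra.
apply: measurableU; first exact: sub_cara.
apply: (@measure_is_complete_caratheodory R T (mu^*)%mu).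
exists B; split => //; first exact: sub_cara.
by rewrite -B0; exact: measurable_mu_extE.
Qed.

Let completed_mu_ext0 : completed_mu_ext set0 = 0%E.
Proof. exact: mu_ext0. Qed.

Let completed_mu_ext_ge0 A : (0 <= completed_mu_ext A)%E.
Proof. exact: mu_ext_ge0. Qed.

Let completed_mu_ext_sigma_additive : semi_sigma_additive completed_mu_ext.
Proof.
move=> F mF tF mUF.
apply: (@caratheodory_measure_sigma_additive R T (mu^*)%mu) => //.
- by move=> i; exact: sub_caratheodory_completion.
- exact: sub_caratheodory_completion.
Qed.

HB.instance Definition _ := isMeasure.Build _ _ _ completed_mu_ext
  completed_mu_ext0 completed_mu_ext_ge0 completed_mu_ext_sigma_additive.

Definition completed_measure : {measure set completion -> \bar R} :=
  completed_mu_ext.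

End completion.

Arguments completion {d T R} mu.
Arguments completed_measure {d T R} mu.

Section vector_integral.
Context d (T : measurableType d) (R : realType) (k : nat).
Variable mu : {measure set T -> \bar R}.
Implicit Type f : T -> 'rV[R]_k.

(* The norm of 'rV[R]_k is the maximum norm; all norms of R ^ k give the same
   integrable functions. *)
Definition vintegrable f :=
  measurable_fun [set: T] (f : T -> borel 'rV[R]_k) /\
  (\int[mu]_w (`|f w|)%:E < +oo)%E.

Definition vintegral (A : set T) f : 'rV[R]_k :=
  \row_j \int[mu]_(w in A) f w ord0 j.

End vector_integral.

Section martingale.
Context d (W : measurableType d) (R : realType) (n : nat).
Variable P : probability W R.

Definition preimage_sigma (Y : W -> 'rV[R]_n) : set (set W) :=
  preimage_set_system [set: W] (Y : W -> borel 'rV[R]_n) measurable.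

(* Y is a version of the conditional expectation of X given the
   sigma-algebra G. *)
Definition is_cond_exp (G : set (set W)) (X Y : W -> 'rV[R]_n) :=
  [/\ preimage_sigma Y `<=` G, vintegrable P Y &
      forall A, G A -> vintegral P A Y = vintegral P A X].

Definition natural_filtration m (M : 'I_m -> W -> 'rV[R]_n) (t : 'I_m) :
    set (set W) :=
  <<s \bigcup_(s in [set s : 'I_m | (s <= t)%N]) preimage_sigma (M s) >>.

Definition is_martingale m (M : 'I_m -> W -> 'rV[R]_n) :=
  (forall t, vintegrable P (M t)) /\
  (forall s t : 'I_m, (s <= t)%N ->
    is_cond_exp (natural_filtration M s) (M t) (M s)).

End martingale.

Definition martingale_law (R : realType) (n T : nat) (x0 : 'rV[R]_n)
    (mu : probability (paths R n T) R) :=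
  is_martingale mu (@coordinate R n T) /\
  {ae mu, forall w, coordinate ord0 w = x0}.

Definition measure_support (R : realType) (T : ptopologicalType)
    (mu : set (borel T) -> \bar R) : set T :=
  [set x | forall U : set T, open U -> U x -> (0 < mu U)%E].

(* Main.v *)
(* The finite martingale is built one time step at a time, backwards. Write g_T
   for f and g_t for the conditional expectation of f given the path up to time
   t. Conditionally on that path, (M_{t+1}, g_{t+1}) is a random vector of
   R^(n + k) with mean (M_t, g_t), which almost surely extends the path to one
   from which the construction can be continued. The mean of a random vector lies
   in the convex hull of any set of almost sure values, so by Caratheodory's
   theorem it is a convex combination of n + k + 1 such values: these are the
   branches at the node. At time 0 the path is x0 and g_0 is the mean of f.

   Conditioning is made pointwise without regular conditional probabilities: by
   quantile transforms, M_{t+1} is realized as a function of the path up to time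
   t and of an independent noise, and Fubini's theorem applies. *)
From HB Require Import structures.
Require Import Defs.
From mathcomp Require Import all_boot all_order all_algebra.
From mathcomp Require Import all_classical all_reals all_analysis.
From mathcomp Require Import measurable_realfun.
From mathcomp Require Import ring lra.

Set Implicit Arguments.
Unset Strict Implicit.
Unset Printing Implicit Defensive.

Import Order.TTheory GRing.Theory Num.Theory.
Import numFieldNormedType.Exports.

Local Open Scope classical_set_scope.
Local Open Scope ring_scope.

(** * Barycenters in finite dimension *)

(* A family [Y : nat -> S -> R] stands for a vector-valued function, of which only
   the first [d] coordinates matter. *)
Section caratheodory.
Context (R : realFieldType) (S : eqType).
Implicit Types (l : seq (R * S)) (Y : nat -> S -> R).

(** Two obstacles shape the proof. The branches at a node must be exact members of an almost sure
    set of values. That set, the values from which a tree can be grown, is given by an existential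
    statement, with neither measurability nor closedness at hand, and separation by hyperplanes
    alone reaches only a closed hull; hence [balanced_combination], which manipulates points. Trees
    too are asserted to exist pointwise, along almost every path, and one is extracted at the
    deterministic starting path: no branch is ever selected measurably. Next, [f] and [A] live on
    the completion of [mu], whereas image laws and Fubini are used on Borel sigma-algebras, and the
    atoms of [nu] may be null for [mu]. So a Borel version replaces [f] inside integrals only;
    equality with it and membership in [A] enter the almost sure event that provides the leaves of
    [tree], where the true values of [f] are read. The dimension [n + k] comes from asking one
    choice of branches to preserve both the mean of the next state, in dimension [n], and the mean
    of the values of [f], in dimension [k]. *)

Lemma affine_dependence (d m : nat) (Y : 'I_m -> 'I_d -> R) : (d.+1 < m)%N ->
  exists u : 'I_m -> R, [/\ exists i, 0 < u i, \sum_i u i = 0 &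
    forall j, \sum_i u i * Y i j = 0].
Proof.
move=> dm.
(* The column of ones turns a left kernel vector into an affine dependence; it exists because the
   rank is at most [d.+1 < m]. *)
pose A : 'M[R]_(m, 1 + d) := row_mx (const_mx 1) (\matrix_(i, j) Y i j).
have rA : (\rank (kermx A) > 0)%N.
  rewrite mxrank_ker subn_gt0 (leq_ltn_trans _ dm)//.
  exact: leq_trans (rank_leq_col _) _.
have /rowV0Pn[u /sub_kermxP uA u0] : kermx A != 0 by rewrite -mxrank_eq0 -lt0n.
have entry j : \sum_i u ord0 i * A i j = 0.
  by have /matrixP/(_ ord0 j) := uA; rewrite !mxE.
have sum_u : \sum_i u ord0 i = 0.
  rewrite -[RHS](entry (lshift d ord0)); apply: eq_bigr => i _.
  by rewrite row_mxEl mxE mulr1.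
have uY j : \sum_i u ord0 i * Y i j = 0.
  rewrite -[RHS](entry (rshift 1 j)); apply: eq_bigr => i _.
  by rewrite row_mxEr mxE.
have [i ui0] : exists i, u ord0 i != 0.
  apply/existsP; apply: contraNT u0 => /existsPn u0.
  by apply/eqP/rowP => i; rewrite mxE; apply/eqP; rewrite -[_ == _]negbK u0.
have [ui|ui|ui] := ltgtP (u ord0 i) 0; last by rewrite ui eqxx in ui0.
- exists (fun i => - u ord0 i); split.
  + by exists i; rewrite oppr_gt0.
  + by rewrite sumrN sum_u oppr0.
  + by move=> j; under eq_bigr do rewrite mulNr; rewrite sumrN uY oppr0.
- by exists (u ord0); split => //; exists i.
Qed.

Lemma caratheodory_step (d : nat) Y l : (d.+1 < size l)%N ->
  (forall p, p \in l -> 0 <= p.1) ->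
  exists l' : seq (R * S), [/\ (size l').+1 = size l,
    forall p, p \in l' -> 0 <= p.1 /\ p.2 \in map snd l,
    \sum_(p <- l') p.1 = \sum_(p <- l) p.1 &
    forall j, (j < d)%N ->
      \sum_(p <- l') p.1 * Y j p.2 = \sum_(p <- l) p.1 * Y j p.2].
Proof.
move=> dl l_ge0; set m := size l in dl *.
pose p i := tnth (in_tuple l) i.
have [u [[i1 ui1] u0 uY]] :=
  affine_dependence (fun i (j : 'I_d) => Y j (p i).2) dl.
have pl i : p i \in l by exact: mem_tnth.
pose i0 := [arg min_(i < i1 | 0 < u i) ((p i).1 / u i)]%O.
have [ui0 mini0] : 0 < u i0 /\
    forall j, 0 < u j -> (p i0).1 / u i0 <= (p j).1 / u j.
  by rewrite /i0; case: arg_minP.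
set t := (p i0).1 / u i0 in mini0.
have t_ge0 : 0 <= t by rewrite divr_ge0 ?l_ge0// ltW.
pose c i := (p i).1 - t * u i.
have c_ge0 i : 0 <= c i.
  rewrite subr_ge0; have [ui|ui] := ltP 0 (u i).
    by rewrite -ler_pdivlMr// mini0.
  by apply: le_trans (l_ge0 _ (pl i)); rewrite mulr_ge0_le0.
have ci0 : c i0 = 0 by rewrite /c /t divfK ?subrr// gt_eqF.
have sumE (F : R * S -> R) : \sum_(q <- l) F q = \sum_i F (p i).
  by rewrite [LHS](big_tnth _ _ l).
have sumcE (F : S -> R) : \sum_i u i * F (p i).2 = 0 ->
    \sum_(i | i != i0) c i * F (p i).2 = \sum_i (p i).1 * F (p i).2.
  move=> uF; transitivity (\sum_i c i * F (p i).2).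
    by rewrite [RHS](bigD1 i0)//= ci0 mul0r add0r.
  under eq_bigr do rewrite mulrBl -mulrA.
  by rewrite sumrB -mulr_sumr uF mulr0 subr0.
exists [seq (c i, (p i).2) | i <- enum (predC1 i0)]; split.
- by rewrite size_map -cardE cardC1 card_ord prednK// (leq_trans _ dl).
- by move=> _ /mapP[i _ ->] /=; split => //; exact: map_f.
- rewrite big_map big_enum/= sumE.
  under eq_bigr do rewrite -[c _]mulr1; under [RHS]eq_bigr do rewrite -[_.1]mulr1.
  by rewrite (sumcE (fun=> 1))//; under eq_bigr do rewrite mulr1.
- by move=> j jd; rewrite big_map big_enum/= sumE (sumcE (Y j) (uY (Ordinal jd))).
Qed.

Lemma caratheodory (d : nat) Y l :
  (forall p, p \in l -> 0 <= p.1) -> \sum_(p <- l) p.1 = 1 ->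
  exists (c : 'I_d.+1 -> R) (s : 'I_d.+1 -> S),
    [/\ forall i, 0 <= c i, \sum_i c i = 1,
        forall i, s i \in map snd l &
        forall j, (j < d)%N ->
          \sum_i c i * Y j (s i) = \sum_(p <- l) p.1 * Y j p.2].
Proof.
have [m] := ubnP (size l); elim: m l => // m IH l lm l_ge0 l1.
have [dl|ld] := ltnP d.+1 (size l).
  have [l' [l'l l'_ge0 l'1 l'Y]] := caratheodory_step Y dl l_ge0.
  have [|||c [s [c0 c1 sl cY]]] := IH l'.
  - by rewrite -ltnS l'l.
  - by move=> p /l'_ge0[].
  - by rewrite l'1.
  exists c, s; split => // [i|j jd]; last by rewrite cY// l'Y.
  by have /mapP[p /l'_ge0[_ ?] ->] := sl i.
case: l => [|p0 l] in lm l_ge0 l1 ld *.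
  by move: l1; rewrite big_nil => /eqP; rewrite eq_sym oner_eq0.
set L := p0 :: l in lm l_ge0 l1 ld *.
(* A list shorter than [d.+1] is padded with zero weights at the point of [p0], the default of
   [nth], so that every [s i] is still a point of the list. *)
pose c i := if (i < size L)%N then (nth p0 L i).1 else 0.
pose s i := (nth p0 L i).2.
have sumE (F : S -> R) : \sum_(i < d.+1) c i * F (s i) =
    \sum_(p <- L) p.1 * F p.2.
  rewrite [RHS](big_nth p0) big_mkord [RHS](big_ord_widen _
    (fun i => (nth p0 L i).1 * F (nth p0 L i).2) ld).
  rewrite [RHS]big_mkcond/=; apply: eq_bigr => i _.
  by rewrite /c /s; case: ifPn; rewrite ?mul0r.
exists c, s; split => //.
- by move=> i; rewrite /c; case: ifPn => // iL; exact/l_ge0/mem_nth.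
- rewrite -l1; transitivity (\sum_(i < d.+1) c i * 1).
    by under [RHS]eq_bigr do rewrite mulr1.
  by rewrite (sumE (fun=> 1)); apply: eq_bigr => p _; rewrite mulr1.
- move=> i; rewrite /s; have [iL|iL] := ltnP i (size L).
    by apply/map_f/mem_nth.
  by rewrite nth_default//= mem_head.
Qed.

End caratheodory.

Section integral_tools.
Local Open Scope ereal_scope.

Lemma integrable_prod d1 d2 (S1 : measurableType d1) (S2 : measurableType d2)
    (R : realType) (m1 : {sigma_finite_measure set S1 -> \bar R})
    (m2 : {sigma_finite_measure set S2 -> \bar R}) (f : S1 -> R) (g : S2 -> R) :
  m1.-integrable setT (EFin \o f) -> m2.-integrable setT (EFin \o g) ->
  (m1 \x m2).-integrable setT (fun z => (f z.1 * g z.2)%:E) /\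
  \int[m1 \x m2]_z (f z.1 * g z.2)%:E = \int[m1]_x (f x)%:E * \int[m2]_y (g y)%:E.
Proof.
move=> intf intg.
have mf : measurable_fun setT f by exact/measurable_EFinP/(measurable_int m1).
have mg : measurable_fun setT g by exact/measurable_EFinP/(measurable_int m2).
have int_fg : (m1 \x m2).-integrable setT (fun z => (f z.1 * g z.2)%:E).
  apply/integrable12ltyP.
    by apply/measurable_EFinP/measurable_funM => //; exact: measurableT_comp.
  under eq_integral => x _.
    under eq_integral => y _ do rewrite /= normrM EFinM.
    rewrite ge0_integralZl_EFin//; last first.
      exact/measurable_EFinP/measurableT_comp.
    over.
  rewrite ge0_integralZr//; last 2 first.
  - exact/measurable_EFinP/measurableT_comp.
  - exact: integral_ge0.
  move/integrableP : intf => [_ intf]; move/integrableP : intg => [_ intg].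
  by rewrite lte_mul_pinfty ?integral_ge0// ge0_fin_numE ?integral_ge0.
split=> //; rewrite -integral12_prod_meas1// /fubini_F.
under eq_integral => x _.
  under eq_integral => y _ do rewrite /= EFinM.
  rewrite integralZl//; over.
have /fineK <- := integrable_fin_num measurableT intg.
by rewrite integralZr.
Qed.

(** Restrictions become indicator factors because [integrable_prod] concerns integrals over the
    whole space. *)
Lemma integrable_indicM d (S : measurableType d) (R : realType)
    (mu : {measure set S -> \bar R}) (D A : set S) (f : S -> R) :
  measurable D -> measurable A -> A `<=` D -> mu.-integrable D (EFin \o f) ->
  mu.-integrable setT (fun x => (\1_A x * f x)%:E) /\
  \int[mu]_x (\1_A x * f x)%:E = \int[mu]_(x in A) (f x)%:E.
Proof.
move=> mD mA AD intf.
have fE : (fun x => (\1_A x * f x)%:E) = (EFin \o f) \_ A.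
  apply/funext => x; rewrite patchE indicE; case: ifPn => _.
    by rewrite mul1r.
  by rewrite mul0r.
rewrite fE; split; last by rewrite [RHS]integral_mkcond.
by apply: (iffLR (integrable_mkcond _ mA)); apply: integrableS intf.
Qed.

End integral_tools.

(* Induction on [d]: pairing a point [s] where [y = Y 0] is nonnegative with a
   point [s'] where [y] is negative, the combinations
   [- y s' * Y j s + y s * Y j s'] vanish at [j = 0], and again have integral
   zero for the product measure. *)
Lemma balanced_combination (R : realType) (n : nat) :
  forall d (S : measurableType d) (mu : probability S R)
    (D P : set S) (Y : nat -> S -> R),
  measurable D -> mu D != 0%E ->
  (forall j, (j < n)%N -> mu.-integrable D (EFin \o Y j)) ->
  (forall j, (j < n)%N -> (\int[mu]_(s in D) (Y j s)%:E = 0)%E) ->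
  {ae mu, forall s, P s} ->
  exists l : seq (R * S), [/\ exists2 p, p \in l & 0 < p.1,
    forall p, p \in l -> [/\ 0 <= p.1, D p.2 & P p.2] &
    forall j, (j < n)%N -> \sum_(p <- l) p.1 * Y j p.2 = 0].
Proof.
elim: n => [|n IH] d S mu D P Y mD D0 intY Y0 aeP.
  have [s [Ds Ps]] : exists s, D s /\ P s.
    apply: contrapT => /forallNP noDP.
    have : mu.-negligible D.
      apply: negligibleS aeP => s Ds /= Ps.
      by have := noDP s; tauto.
    by move/(measure_negligible mD)/eqP; rewrite (negbTE D0).
  exists [:: (1, s)]; split => //.
    by exists (1, s) => //=; rewrite mem_head.
  by move=> p; rewrite inE => /eqP ->.
pose y := Y 0%N.
have inty : mu.-integrable D (EFin \o y) by exact: intY.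
have my : measurable_fun D y by exact/measurable_EFinP/(measurable_int mu).
pose Dp := D `&` [set s | 0 <= y s]; pose Dn := D `&` [set s | y s < 0].
have mDp : measurable Dp.
  rewrite /Dp (_ : [set s | 0 <= y s] = y @^-1` `[0, +oo[); last first.
    by apply/seteqP; split => s /=; rewrite in_itv/= andbT.
  exact: my.
have mDn : measurable Dn.
  rewrite /Dn (_ : [set s | y s < 0] = y @^-1` `]-oo, 0[); last first.
    by apply/seteqP; split => s /=; rewrite in_itv/=.
  exact: my.
have DE : D = Dp `|` Dn.
  rewrite -setIUr (_ : _ `|` _ = setT) ?setIT//.
  by apply/seteqP; split => // s _ /=; case: ltP; [right|left].
have Dpn : [disjoint Dp & Dn].
  apply/disj_setPLR => s [_ /= y0] [_ /=]; by rewrite ltNge y0.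
have splitD j : (j < n.+1)%N ->
  (\int[mu]_(s in Dp) (Y j s)%:E + \int[mu]_(s in Dn) (Y j s)%:E = 0)%E.
  move=> jn; rewrite -[RHS](Y0 _ jn) DE integral_setU//.
  by rewrite -DE; exact/(measurable_int mu)/intY.
have DpD : Dp `<=` D by exact: subIsetl.
have DnD : Dn `<=` D by exact: subIsetl.
have fin j A : (j < n.+1)%N -> measurable A -> A `<=` D ->
    exists r, (\int[mu]_(s in A) (Y j s)%:E = r%:E)%E.
  move=> jn mA AD; exists (fine (\int[mu]_(s in A) (Y j s)%:E)%E).
  rewrite fineK//; apply: integrable_fin_num => //.
  by apply: integrableS (intY _ jn).
have [a aE] := fin 0%N Dp isT mDp DpD.
have aE' : (\int[mu]_(s in Dn) (y s)%:E = (- a)%:E)%E.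
  have [b bE] := fin 0%N Dn isT mDn DnD.
  have := splitD 0%N isT; rewrite aE bE => /eqP; rewrite -EFinD eqe addr_eq0.
  by move=> /eqP ab; rewrite ab opprK.
(* If [a = 0], both signed parts of [y] integrate to zero, so [y] vanishes almost everywhere on [D].
   The coordinate is then absorbed into the almost sure condition, and the induction continues on
   the same space. *)
have [a0|a0] := eqVneq a 0.
  have y0 : ae_eq mu D (EFin \o y) (cst 0%E).
    apply/ae_eq_integral_abs => //; first exact: measurable_int inty.
    rewrite {1}DE integral_setU//; last first.
      by rewrite -DE; apply: measurableT_comp => //; exact: measurable_int inty.
    rewrite (eq_integral (EFin \o y)); last first.
      by move=> s /set_mem[_ /= ?]; rewrite ger0_norm.
    rewrite [X in (_ + X)%E](eq_integral (fun s => - (y s)%:E)%E); last first.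
      by move=> s /set_mem[_ /= ?]; rewrite ltr0_norm.
    rewrite integralN/=; last first.
      by apply: integrable_add_def => //; apply: integrableS inty.
    by rewrite [X in (X - _)%E]aE aE' a0 oppr0 oppe0 adde0.
  have aeP' : {ae mu, forall s, (P `&` [set s | D s -> y s = 0]) s}.
    by apply: filterS2 aeP y0 => s Ps ys; split => //= /ys -[].
  have [||l [l1 l2 l3]] := IH d S mu D _ (fun j => Y j.+1) mD D0 _ _ aeP'.
  - by move=> j jn; exact: (intY j.+1 jn).
  - by move=> j jn; exact: (Y0 j.+1 jn).
  exists l; split => //; first by move=> p /l2[? ? []].
  move=> [_|j]; last exact: l3.
  rewrite big_seq big1// => p /l2[_ Dp2 [_ /= /(_ Dp2) y0p]].
  by rewrite -/y y0p mulr0.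
(* Otherwise neither part is null, which makes the product of [Dp] and [Dn] a legitimate domain for
   the induction hypothesis. *)
have Dp0 : mu Dp != 0%E.
  apply: contra_neq a0 => Dp0; apply: EFin_inj; rewrite -aE.
  rewrite null_set_integral//; apply: (measurable_int mu);
    by apply: integrableS inty.
have Dn0 : mu Dn != 0%E.
  apply: contra_neq a0 => Dn0; apply: oppr_inj; rewrite oppr0.
  apply: EFin_inj; rewrite -aE'.
  rewrite null_set_integral//; apply: (measurable_int mu);
    by apply: integrableS inty.
pose W j (z : S * S) := - y z.2 * Y j z.1 + y z.1 * Y j z.2.
have intW j : (j < n.+1)%N -> (mu \x mu)%E.-integrable (Dp `*` Dn) (EFin \o W j) /\
    (\int[mu \x mu]_(z in Dp `*` Dn) (W j z)%:E = 0)%E.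
  move=> jn.
  have [iyp yp] := integrable_indicM mD mDp DpD inty.
  have [iyn yn] := integrable_indicM mD mDn DnD inty.
  have [iYp Yp] := integrable_indicM mD mDp DpD (intY _ jn).
  have [iYn Yn] := integrable_indicM mD mDn DnD (intY _ jn).
  have [i1 e1] := integrable_prod iYp iyn.
  have [i2 e2] := integrable_prod iyp iYn.
  have WE : (EFin \o W j) \_ (Dp `*` Dn) = (fun z : S * S =>
      (\1_Dp z.1 * y z.1 * (\1_Dn z.2 * Y j z.2))%:E -
      (\1_Dp z.1 * Y j z.1 * (\1_Dn z.2 * y z.2))%:E)%E.
    apply/funext => -[s s']; rewrite patchE/= in_setX !indicE/= -EFinB.
    case: (s \in Dp); case: (s' \in Dn) => /=; congr EFin;
      rewrite ?mul0r ?mulr0 ?mul0r ?subrr// /W/=; ring.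
  rewrite integral_mkcond WE; split.
    apply/integrable_mkcond; first exact: measurableX.
    by rewrite WE; exact: integrableB.
  (* The integral is [a * q - p * (- a) = a * (p + q)], and [p + q = 0] is the hypothesis on [Y j]
     split over [Dp] and [Dn]. *)
  rewrite integralB// e1 e2 yp yn Yp Yn aE aE'.
  have [p pE] := fin _ _ jn mDp DpD; have [q qE] := fin _ _ jn mDn DnD.
  have := splitD _ jn; rewrite pE qE => /eqP; rewrite -!EFinD eqe => /eqP pq.
  congr EFin.
  by rewrite mulrN opprK mulrC -mulrDl addrC pq mul0r.
have aeP2 : {ae (mu \x mu)%E, forall z, (P z.1 /\ P z.2)}.
  have [N [mN N0 PN]] := aeP.
  exists (N `*` setT `|` setT `*` N); split.
  - by apply: measurableU; exact: measurableX.
  - have e1 : (mu \x mu)%E (N `*` setT) = 0%E.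
      by rewrite [LHS]product_measure1E//= N0 mul0e.
    have e2 : (mu \x mu)%E (setT `*` N) = 0%E.
      by rewrite [LHS]product_measure1E//= N0 mule0.
    by rewrite measureU0//; exact: measurableX.
  - move=> z /= /not_andP[] Pz; [left|right]; split => //; exact: PN.
have [||||l [[p pl p0] l2 l3]] := IH _ _ (mu \x mu)%E (Dp `*` Dn) _
    (fun j => W j.+1) _ _ _ _ aeP2.
- exact: measurableX.
- by rewrite [X in X != _]product_measure1E// mule_neq0.
- by move=> j jn; exact: (intW j.+1 jn).1.
- by move=> j jn; exact: (intW j.+1 jn).2.
exists ([seq (q.1 * - y q.2.2, q.2.1) | q <- l] ++
        [seq (q.1 * y q.2.1, q.2.2) | q <- l]); split.
(* The strict sign of [y] on [Dn] keeps one weight positive, hence a nonzero total to divide by in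
   [barycenter]. *)
- have [_ [_ [_ /= yp]] _] := l2 _ pl.
  exists (p.1 * - y p.2.2, p.2.1); last by rewrite /= mulr_gt0// oppr_gt0.
  by rewrite mem_cat; apply/orP; left; apply/mapP; exists p.
- move=> q; rewrite mem_cat => /orP[] /mapP[r /l2[r0 [[D1 /= y1] [D2 /= y2]]]].
    by move=> [P1 P2] -> /=; split => //; rewrite mulr_ge0// oppr_ge0 ltW.
  by move=> [P1 P2] -> /=; split => //; rewrite mulr_ge0.
- move=> j jn; rewrite big_cat/= !big_map -big_split/=.
  transitivity (\sum_(q <- l) q.1 * W j q.2).
    by apply: eq_bigr => q _; rewrite /W mulrDr !mulrA.
  case: j jn => [_|j jn]; last exact: l3.
  by rewrite big1// => q _; rewrite /W -/y mulNr (mulrC (y _)) addNr mulr0.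
Qed.

(** Centering each coordinate at its mean reduces this to [balanced_combination] on the whole space.
    Dividing by the total weight gives a convex combination, which Caratheodory's theorem
    shortens. *)
Lemma barycenter (R : realType) (n : nat) d (S : measurableType d)
    (mu : probability S R) (P : set S) (Y : nat -> S -> R) :
  (forall j, (j < n)%N -> mu.-integrable setT (EFin \o Y j)) ->
  {ae mu, forall s, P s} ->
  exists (c : 'I_n.+1 -> R) (s : 'I_n.+1 -> S),
    [/\ forall i, 0 <= c i, \sum_i c i = 1, forall i, P (s i) &
      forall j, (j < n)%N ->
        (\int[mu]_s (Y j s)%:E = (\sum_i c i * Y j (s i))%:E)%E].
Proof.
move=> intY aeP; pose m j := fine (\int[mu]_s (Y j s)%:E)%E.
have mE j : (j < n)%N -> (\int[mu]_s (Y j s)%:E = (m j)%:E)%E.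
  by move=> jn; rewrite fineK//; apply: integrable_fin_num => //; exact: intY.
have intm j : mu.-integrable setT (fun=> (m j)%:E).
  exact: finite_measure_integrable_cst.
have [|||l [[p pl p0] l2 l3]] := @balanced_combination R n d S mu setT P
    (fun j s => Y j s - m j) measurableT _ _ _ aeP.
- by rewrite probability_setT.
- by move=> j jn; apply: (integrableB measurableT (intY _ jn) (intm j)).
- move=> j jn; under eq_integral do rewrite EFinB.
  rewrite integralB//=; last exact: intY.
  by rewrite mE// integral_cst//= probability_setT mule1 subee.
pose r := \sum_(q <- l) q.1.
have r0 : 0 < r.
  rewrite /r (perm_big _ (perm_to_rem pl)) big_cons ltr_pwDl//.
  rewrite big_seq sumr_ge0// => q /mem_rem ql.
  by have [] := l2 _ ql.
pose L := [seq (q.1 / r, q.2) | q <- l].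
have L0 q : q \in L -> 0 <= q.1 /\ P q.2.
  by move=> /mapP[q' /l2[? _ ?] ->] /=; split => //; rewrite divr_ge0// ltW.
have L1 : \sum_(q <- L) q.1 = 1.
  by rewrite big_map -mulr_suml divff// gt_eqF.
have [|c [s [c0 c1 sL cY]]] := @caratheodory R S n Y L _ L1.
  by move=> q /L0[].
exists c, s; split => // [i|j jn].
  by have /mapP[q /L0[_ ?] ->] := sL i.
rewrite mE// cY// big_map; congr EFin.
under eq_bigr do rewrite mulrAC.
rewrite -mulr_suml; apply/eqP; rewrite eq_sym -subr_eq0.
have := l3 j jn; under eq_bigr do rewrite mulrBr.
rewrite sumrB -mulr_suml -/r => /subr0_eq ->.
by rewrite mulrAC divff ?mul1r ?subrr// gt_eqF.
Qed.

(** * Laws and conditional laws *)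

Section law.
Context d1 d2 (T1 : measurableType d1) (T2 : measurableType d2) (R : realType).
Variables (P : probability T1 R) (X : T1 -> T2).
Hypothesis mX : measurable_fun setT X.

Let mX_mixin := isMeasurableFun.Build _ _ _ _ _ mX.
Let mX_pack : {mfun T1 >-> T2} := HB.pack X mX_mixin.

Definition law : probability T2 R := distribution P mX_pack.

Lemma lawE A : law A = P (X @^-1` A).
Proof. by []. Qed.

Lemma ge0_integral_law D (g : T2 -> \bar R) :
  measurable D -> measurable_fun D g -> {in D, forall y, (0 <= g y)%E} ->
  (\int[law]_(y in D) g y = \int[P]_(x in X @^-1` D) g (X x))%E.
Proof. exact: ge0_integral_pushforward. Qed.

Lemma integrable_law (g : T2 -> \bar R) : measurable_fun setT g ->
  law.-integrable setT g <-> P.-integrable setT (g \o X).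
Proof.
move=> mg; split=> /integrableP[_ ig]; apply/integrableP; split => //.
- exact: measurableT_comp.
- apply: le_lt_trans ig; rewrite ge0_integral_law//.
  exact: measurableT_comp.
- apply: le_lt_trans ig; rewrite ge0_integral_law//.
  exact: measurableT_comp.
Qed.

Lemma integral_law D (g : T2 -> \bar R) :
  measurable D -> law.-integrable setT g ->
  (\int[law]_(y in D) g y = \int[P]_(x in X @^-1` D) g (X x))%E.
Proof.
move=> mD ig; have mg := measurable_int _ ig.
apply: integral_pushforward => //.
apply: (integrableS measurableT) => //.
  by rewrite -[X in measurable X]setTI; exact: mX.
exact/integrable_law.
Qed.

End law.

Section measure_equality.
Context (R : realType).

Lemma eq_probability_prod d1 d2 (T1 : measurableType d1) (T2 : measurableType d2)
    (P P' : probability (T1 * T2)%type R) :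
  (forall A B, measurable A -> measurable B -> P (A `*` B) = P' (A `*` B)) ->
  forall C, measurable C -> P C = P' C.
Proof.
move=> PP' C mC; pose G : set (set (T1 * T2)) :=
  [set C | exists A B, [/\ measurable A, measurable B & C = A `*` B]].
apply: (measure_unique G (fun=> setT)) => //.
- rewrite measurable_prod_measurableType; congr (<<s _ >>).
  apply/seteqP; split => [_ [A mA [B mB <-]]|_ [A [B [mA mB ->]]]].
    by exists A, B.
  by exists A => //; exists B.
- move=> _ _ [A [B [mA mB ->]]] [A' [B' [mA' mB' ->]]].
  exists (A `&` A'), (B `&` B'); rewrite setXI; split => //; exact: measurableI.
- by move=> _; exists setT, setT; rewrite setXTT.
- by rewrite bigcup_const//; exists 0%N.
- by move=> _ [A [B [mA mB ->]]]; exact: PP'.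
- by move=> _; rewrite (le_lt_trans (probability_le1 _ _))// ltry.
Qed.

Lemma eq_measure_ereal (m m' : {finite_measure set \bar R -> \bar R}) :
  m setT = m' setT ->
  (forall r : R, m [set x | (x < r%:E)%E] = m' [set x | (x < r%:E)%E]) ->
  forall A, measurable A -> m A = m' A.
Proof.
(* No ray contains [+oo], so the whole space joins the pi-system to provide an exhausting
   sequence. *)
move=> mT mr A mA; pose G : set (set \bar R) :=
  [set B | B = setT \/ exists r : R, B = [set x | (x < r%:E)%E]].
have rayE (r : R) : `]-oo, r%:E[%classic = [set x : \bar R | (x < r%:E)%E].
  by apply/seteqP; split => x /=; rewrite in_itv.
apply: (measure_unique G (fun=> setT)) => //.
- rewrite [LHS]ErealGenInftyO.measurableE; apply/seteqP; split.
    apply: smallest_sub; first exact: smallest_sigma_algebra.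
    move=> _ [r ->]; apply: sub_sigma_algebra; right; exists r.
    exact: rayE.
  apply: smallest_sub; first exact: smallest_sigma_algebra.
  move=> _ [->|[r ->]].
    by rewrite -setC0; apply: sigma_algebraC; exact: sigma_algebra0.
  by apply: sub_sigma_algebra; exists r; rewrite rayE.
- move=> B B' [->|[r ->]] [->|[r' ->]]; rewrite ?setIT ?setTI; [by left|..].
  + by right; exists r'.
  + by right; exists r.
  right; exists (Num.min r r'); apply/seteqP; split => x /=.
    by move=> [xr xr']; rewrite EFin_min lt_min xr xr'.
  by rewrite EFin_min lt_min => /andP.
- by move=> _; left.
- by rewrite bigcup_const//; exists 0%N.
- by move=> _ [->|[r ->]]; [exact: mT|exact: mr].
- by move=> _; rewrite -ge0_fin_numE// fin_num_measure.
Qed.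

End measure_equality.

Section ae_le.
Context d (T : measurableType d) (R : realType).

Lemma ae_le_integral (mu : {measure set T -> \bar R}) (f g : T -> R) :
  mu.-integrable setT (EFin \o f) -> mu.-integrable setT (EFin \o g) ->
  (forall A, measurable A ->
    (\int[mu]_(x in A) (f x)%:E <= \int[mu]_(x in A) (g x)%:E)%E) ->
  {ae mu, forall x, f x <= g x}.
Proof.
move=> intf intg fg.
have mf : measurable_fun setT f by exact/measurable_EFinP/(measurable_int mu).
have mg : measurable_fun setT g by exact/measurable_EFinP/(measurable_int mu).
pose A := [set x | g x < f x].
have mA : measurable A.
  rewrite /A (_ : mkset _ = (f \- g) @^-1` `]0, +oo[); last first.
    by apply/seteqP; split => x /=; rewrite in_itv/= andbT subr_gt0.
  by rewrite -[X in measurable X]setTI; apply: measurable_funB.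
have intfA : mu.-integrable A (EFin \o f) by apply: integrableS intf.
have intgA : mu.-integrable A (EFin \o g) by apply: integrableS intg.
have int0 : (\int[mu]_(x in A) `|(f x - g x)%:E| = 0)%E.
  under eq_integral => x /set_mem xA.
    rewrite gee0_abs; last by rewrite lee_fin subr_ge0 ltW.
    rewrite EFinB; over.
  apply/eqP; rewrite eq_le; apply/andP; split.
    rewrite integralB// sube_le0; exact: fg.
  by apply: integral_ge0 => x Ax; rewrite -EFinB lee_fin subr_ge0 ltW.
have /ae_eq_integral_abs : measurable_fun A (fun x => (f x - g x)%:E).
  by apply/measurable_EFinP/measurable_funTS/measurable_funB.
move=> /(_ mu mA)[/(_ int0) ae0 _].
apply: filterS ae0 => x /= fgx; rewrite leNgt; apply/negP => xA.
by have [/eqP] := fgx xA; rewrite subr_eq0 gt_eqF.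
Qed.

End ae_le.

(* [cut D] is the function with strict sublevel sets [D q]; it is [+oo] or
   [-oo] where the family [D] is not that of a real-valued function. *)
Section cut.
Context (R : realType) (T : Type).
Implicit Types D : rat -> set T.

Definition cut D (x : T) : \bar R :=
  ereal_inf [set (ratr q)%:E | q in [set q | D q x]].

Lemma cut_ltP D x (r : R) :
  (cut D x < r%:E)%E <-> exists2 q, ratr q < r & D q x.
Proof.
split=> [|[q qr Dqx]].
  by move/ereal_inf_lt => [_ [q Dqx <-]]; rewrite lte_fin; exists q.
apply: (@le_lt_trans _ _ (ratr q)%:E); last by rewrite lte_fin.
by apply: ereal_inf_lbound; exists q.
Qed.

Lemma cut_fin D x (r : R) : (forall q, D q x <-> r < ratr q) ->
  cut D x = r%:E.
Proof.
move=> Dx; apply/eqP; rewrite eq_le; apply/andP; split.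
  apply/lee_addgt0Pr => e e0; rewrite -EFinD ltW//; apply/cut_ltP.
  have /rat_in_itvoo[q] : r < r + e by rewrite ltrDl.
  by rewrite in_itv/= => /andP[rq qe]; exists q => //; exact/Dx.
by apply: le_ereal_inf_tmp => _ [q /Dx rq <-]; rewrite lee_fin ltW.
Qed.

End cut.

Lemma measurable_cut d (T : measurableType d) (R : realType) (D : rat -> set T) :
  (forall q, measurable (D q)) -> measurable_fun setT (@cut R T D).
Proof.
move=> mD; apply: (measurability _ (ErealGenInftyO.measurableE R)).
move=> _ [_ [r ->] <-]; rewrite setTI.
rewrite (_ : _ @^-1` _ = \bigcup_(q in [set q : rat | (ratr q < r)%R]) D q).
  by rewrite bigcup_mkcond; apply: bigcupT_measurable_rat => q; case: ifPn.
apply/seteqP; split => x /=; rewrite in_itv/=.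
  by move/cut_ltP => [q qr Dq]; exists q.
by move=> [q qr Dq]; apply/cut_ltP; exists q.
Qed.

Lemma uniform_law_exists (R : realType) :
  exists d (S : measurableType d) (lam : probability S R) (u : S -> R),
    measurable_fun setT u /\
    forall x : R, 0 <= x <= 1 -> lam [set s | u s < x] = x%:E.
Proof.
exists _, _, (uniform_prob (@ltr01 R)), id; split; first exact: measurable_id.
move=> x /andP[x0 x1].
rewrite [LHS]integral_uniform_pdf (eq_integral (fun=> 1%E)); last first.
  move=> y /set_mem[_] /=; rewrite in_itv/= /uniform_pdf => ->.
  by rewrite subr0 invr1.
rewrite (_ : _ `&` _ = `[0, x[%classic); last first.
  apply/seteqP; split => y /=; rewrite !in_itv/=.
    by move=> [-> /andP[-> _]].
  by move=> /andP[-> yx]; rewrite yx (ltW (lt_le_trans yx x1)).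
rewrite integral_cst//= mul1e lebesgue_measure_itv/= lte_fin.
case: ltP => [_|x0']; first by rewrite oppr0 adde0.
by have -> : x = 0 by apply/eqP; rewrite eq_le x0 x0'.
Qed.

(** Packed as a finite measure, the restricted image is accepted by the Radon-Nikodym theorem and by
    the uniqueness theorem for measures. *)
Lemma restricted_law_exists d d' (T : measurableType d) (T' : measurableType d')
    (R : realType) (P : probability T R) (X : T -> T') (D : set T) :
  measurable_fun setT X -> measurable D ->
  exists nu : {finite_measure set T' -> \bar R},
    forall B, nu B = P (D `&` X @^-1` B).
Proof.
move=> mX mD; pose nu B := P (D `&` X @^-1` B).
have mXB B : measurable B -> measurable (D `&` X @^-1` B).
  move=> mB; apply: measurableI => //.
  by rewrite -[X in measurable X]setTI; exact: mX.
have nu0 : nu set0 = 0%E by rewrite /nu preimage_set0 setI0 measure0.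
have nu_ge0 B : (0 <= nu B)%E by exact: measure_ge0.
have nu_sigma : semi_sigma_additive nu.
  move=> B mB tB mUB; rewrite /nu preimage_bigcup setI_bigcupr.
  apply: measure_semi_sigma_additive.
  - by move=> i; exact: mXB.
  - move=> i j _ _ [x [[_ /= Bi] [_ /= Bj]]].
    by apply: tB => //; exists (X x).
  - by apply: bigcupT_measurable => i; exact: mXB.
have nu_fin : fin_num_fun nu.
  by move=> B mB; rewrite fin_num_measure//; exact: mXB.
pose nu_measure := isMeasure.Build _ _ _ nu nu0 nu_ge0 nu_sigma.
pose nuM : {measure set T' -> \bar R} := HB.pack nu nu_measure.
pose nu_finite := Measure_isFinite.Build _ _ _ nuM nu_fin.
by exists (HB.pack_for {finite_measure set T' -> \bar R} (Measure.sort nuM)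
  nu_measure nu_finite).
Qed.

Lemma ae_forall_countable (I : countType) d (T : measurableType d) (R : realType)
    (mu : {measure set T -> \bar R}) (P : I -> T -> Prop) :
  (forall i, {ae mu, forall x, P i x}) -> {ae mu, forall x, forall i, P i x}.
Proof.
move=> aeP; pose P' n x := if unpickle n is Some i then P i x else True.
have /ae_foralln : forall n, {ae mu, forall x, P' n x}.
  move=> n; rewrite /P'; case: (unpickle n) => [i|]; first exact: aeP.
  exact: aeW.
by apply: filterS => x Px i; have := Px (pickle i); rewrite /P' pickleK.
Qed.

(* A substitute for disintegration along [fst]: under every joint law, the second
   component can be replaced by a function of the first one and of an
   independent noise. *)
Definition transfers (R : realType) dZ (Z : measurableType dZ) :=
  forall dE (E : measurableType dE) (m : probability (E * Z)%type R),
  exists dS (S : measurableType dS) (lam : probability S R) (Q : E * S -> Z),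
    measurable_fun setT Q /\
    forall C, measurable C ->
      m C = (law m (@measurable_fst _ _ E Z) \x lam)%E
              [set z : E * S | C (z.1, Q z)].

Section transfer_real.
Context (R : realType) dE (E : measurableType dE).
Variable m : probability (E * R)%type R.

Let mE : probability E R := law m (@measurable_fst _ _ E R).

Let ray (r : R) : set R := [set x | x < r].

Let measurable_ray r : measurable (ray r).
Proof.
rewrite /ray (_ : mkset _ = `]-oo, r[%classic); first exact: measurable_itv.
by apply/seteqP; split => x /=; rewrite in_itv.
Qed.

(** [F r] is the Radon-Nikodym density, with respect to the first marginal, of the mass that [m]
    puts on [ray r] above [B]. Such densities behave like distribution functions in [r] only up to
    null sets depending on the levels compared. *)
Let conditional_cdf_exists : exists F : R -> E -> R,
  [/\ forall r, measurable_fun setT (F r), forall r e, 0 <= F r e,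
      forall r, mE.-integrable setT (EFin \o F r) &
      forall r B, measurable B ->
        m (B `*` ray r) = (\int[mE]_(e in B) (F r e)%:E)%E].
Proof.
suff /choice[F FP] : forall r, exists Fr : E -> R,
  [/\ measurable_fun setT Fr, forall e, 0 <= Fr e,
      mE.-integrable setT (EFin \o Fr) &
      forall B, measurable B ->
        m (B `*` ray r) = (\int[mE]_(e in B) (Fr e)%:E)%E].
  by exists F; split => r; have [] := FP r.
move=> r.
have mTr : measurable ([set: E] `*` ray r) by exact: measurableX.
have [nu nuE'] := restricted_law_exists m (@measurable_fst _ _ E R) mTr.
have nuE B : nu B = m (B `*` ray r).
  by rewrite nuE'; congr (m _); apply/seteqP; split => -[e x] /=; tauto.
have [|f [f0 ffin intf fE]] := @radon_nikodym_sigma_finite _ _ _ mE nu.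
  apply/null_content_dominatesP => B mB mB0; apply/eqP; rewrite -measure_le0.
  rewrite -mB0 [leLHS]nuE.
  change (m (B `*` ray r) <= m (fst @^-1` B))%E.
  rewrite le_measure ?inE//; last by move=> z [].
    exact: measurableX.
  by rewrite -[X in measurable X]setTI; exact: measurable_fst.
have fineE : EFin \o (fine \o f) = f.
  by apply/funext => e; rewrite /= fineK.
have mf : measurable_fun setT (fine \o f).
  by apply/measurable_EFinP; rewrite fineE; exact: (measurable_int mE).
exists (fine \o f); split => //.
- by move=> e; rewrite fine_ge0.
- by rewrite fineE.
- move=> B mB; rewrite -nuE [LHS]fE//.
  by apply: eq_integral => e _; rewrite /= fineK.
Qed.

(* Conditionally on [e], [Q] is the quantile transform of a uniform variable. *)
Lemma transfer_real :
  exists dS (S : measurableType dS) (lam : probability S R) (Q : E * S -> R),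
    measurable_fun setT Q /\
    forall C, measurable C ->
      m C = (mE \x lam)%E [set z : E * S | C (z.1, Q z)].
Proof.
have [F [mF F0 intF FE]] := conditional_cdf_exists.
have [dS [S [lam [u [mu ulaw]]]]] := uniform_law_exists R.
have mfstB (B : set E) : measurable B -> measurable (fst @^-1` B : set (E * R)).
  by move=> mB; rewrite -[X in measurable X]setTI; exact: measurable_fst.
have F1 r : {ae mE, forall e, F r e <= 1}.
  apply: ae_le_integral => //.
    exact: finite_measure_integrable_cst.
  move=> B mB; rewrite -FE// integral_cst// mul1e.
  change (m (B `*` ray r) <= m (fst @^-1` B))%E.
  rewrite le_measure ?inE//; [exact: measurableX|exact: mfstB|by move=> z []].
have FF q r : q <= r -> {ae mE, forall e, F q e <= F r e}.
  move=> qr; apply: ae_le_integral => // B mB; rewrite -!FE//.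
  rewrite le_measure ?inE//; [exact: measurableX|exact: measurableX|].
  by move=> [e x] [/= Be xq]; split => //=; exact: lt_le_trans xq qr.
pose D r := [set z : E * S | u z.2 < F r z.1].
have mD r : measurable (D r).
  rewrite /D (_ : mkset _ = (fun z => F r z.1 - u z.2) @^-1` `]0, +oo[); last first.
    by apply/seteqP; split => z /=; rewrite in_itv/= andbT subr_gt0.
  rewrite -[X in measurable X]setTI; apply: measurable_funB => //.
    exact: measurableT_comp.
  exact: measurableT_comp.
have mXT B : measurable B -> measurable (B `*` [set: S]).
  by move=> mB; exact: measurableX.
have mDB r B : measurable B -> measurable (D r `&` B `*` [set: S]).
  by move=> mB; apply: measurableI => //; exact: mXT.
(* The fiber of [D r] at [e] is the event [u < F r e], of mass [F r e] by uniformity once that value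
   lies between 0 and 1. *)
have DE r B : measurable B ->
    (mE \x lam)%E (D r `&` B `*` setT) = m (B `*` ray r).
  move=> mB; rewrite FE// integral_mkcond.
  have mDrB := mDB r B mB.
  apply: ge0_ae_eq_integral => //.
  - exact: measurable_fun_xsection.
  - apply/(measurable_restrictT _ mB); exact/measurable_EFinP/measurable_funTS.
  - by move=> e _; rewrite erestrict_ge0// => e' _; rewrite lee_fin.
  apply: filterS (F1 r) => e Fe1 _ /=; rewrite patchE.
  case: ifPn => eB.
    rewrite -ulaw ?F0//; congr (lam _); apply/seteqP; split => s.
      by rewrite /xsection/= => /set_mem[].
    by rewrite /xsection/= => us; apply/mem_set; split => //; split => //; exact: set_mem.
  rewrite (_ : xsection _ e = set0) ?measure0//.
  apply/seteqP; split => // s; rewrite /xsection/= => /set_mem[_ [/= Be _]].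
  by move: eB; rewrite notin_setE.
(* Only rational levels are used, so that countably many almost sure comparisons suffice. The values
   are extended because at exceptional points the family need not come from a real number. *)
pose Qbar := cut R (fun q => D (ratr q)).
have mQbar : measurable_fun setT Qbar by apply: measurable_cut => q; exact: mD.
pose V r B := [set z : E * S | (Qbar z < r%:E)%E] `&` B `*` [set: S].
have mV r B : measurable B -> measurable (V r B).
  move=> mB; apply: measurableI; last exact: mXT.
  by rewrite -[X in measurable X]setTI; exact: emeasurable_fun_infty_o.
have VE r B : measurable B -> (mE \x lam)%E (V r B) = m (B `*` ray r).
  move=> mB; apply/eqP; rewrite eq_le; apply/andP; split.
    (* Upper bound: off a null set of [e], [F] at the rationals below [r] is at most [F r], so the
       event [Qbar < r] lies in [D r]. *)
    have : {ae mE, forall e, forall q : rat, (ratr q < r) -> F (ratr q) e <= F r e}.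
      apply: ae_forall_countable => q; case: (ltP (ratr q) r) => qr; last by apply: aeW.
      by apply: filterS (FF _ _ (ltW qr)) => e Fe _.
    move=> [N [mN N0 FN]]; rewrite -DE//.
    have -> : (mE \x lam)%E (D r `&` B `*` setT) =
        (mE \x lam)%E (D r `&` B `*` setT `|` N `*` setT).
      apply/esym/measureU0; [exact: mDB|exact: mXT|].
      by rewrite [LHS]product_measure1E//= N0 mul0e.
    rewrite le_measure ?inE//; [exact: mV|by apply: measurableU; [exact: mDB|exact: mXT]|].
    move=> [e s] [/= /cut_ltP[q qr Dq] Be].
    have [Ne|Ne] := pselect (N e); [by right|left; split => //].
    have Fe : forall q : rat, ratr q < r -> F (ratr q) e <= F r e.
      by apply: contrapT => Fe; apply: Ne; exact: FN.
    exact: lt_le_trans Dq (Fe _ qr).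
  (* Lower bound: the strict ray is the increasing union of the rays at [s n], and a rational [q]
     between [s n] and [r] puts [D (ratr q)] inside the event [Qbar < r]. *)
  pose s n := r - n.+1%:R^-1.
  have sr n : s n < r by rewrite ltrBlDr ltrDl invr_gt0.
  have -> : B `*` ray r = \bigcup_n (B `*` ray (s n)).
    apply/seteqP; split => [[e x] [/= Be xr]|[e x] [n _ [/= Be xs]]]; last first.
      by split => //=; exact: lt_trans xs (sr n).
    have rx : 0 < r - x by rewrite subr_gt0.
    have [n _ /(_ n (leqnn n)) /= rn] := near_infty_natSinv_lt (PosNum rx).
    by exists n => //; split => //; rewrite /ray/= /s ltrBrDr addrC -ltrBrDr.
  have cvgm : (m \o (fun n => B `*` ray (s n))) n @[n --> \oo] -->
      m (\bigcup_n (B `*` ray (s n))).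
    apply: nondecreasing_cvg_mu => //.
    - by move=> n; exact: measurableX.
    - by apply: bigcupT_measurable => n; exact: measurableX.
    - move=> n k nk; apply/subsetPset => -[e x] [/= Be xs]; split => //=.
      apply: lt_le_trans xs _; rewrite lerB// lef_pV2 ?posrE//.
      by rewrite ler_nat.
  rewrite -(cvg_lim _ cvgm)//; apply: lime_le; first by apply/cvg_ex; eexists; exact: cvgm.
  apply: nearW => n /=.
  have [q /[!in_itv]/= /andP[sq qr]] := rat_in_itvoo (sr n).
  apply: (@le_trans _ _ (m (B `*` ray (ratr q)))).
    rewrite le_measure ?inE//; [exact: measurableX|exact: measurableX|].
    by move=> [e x] [/= Be xs]; split => //=; exact: lt_trans xs sq.
  rewrite -DE// le_measure ?inE//; [exact: mDB|exact: mV|].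
  move=> [e x] [/= De Be]; split => //=.
  by apply/cut_ltP; exists q.
have mPhi : measurable_fun setT (fun z : E * S => (z.1, Qbar z)).
  exact: measurable_fun_pair.
have mPsi : measurable_fun setT (fun z : E * R => (z.1, z.2%:E)).
  by apply: measurable_fun_pair => //; exact: measurableT_comp.
exists dS, S, lam, (fine \o Qbar); split; first exact: measurableT_comp.
move=> C mC.
(* The laws are compared with values in the extended reals, where [Qbar] lives; applying [fine]
   afterwards undoes the embedding on the side of [m]. *)
suff lawPQ A : measurable A -> law (mE \x lam)%E mPhi A = law m mPsi A.
  have mfine : measurable_fun setT (fun z : E * \bar R => (z.1, fine z.2)).
    by apply: measurable_fun_pair => //; exact: measurableT_comp.
  have mC' : measurable [set z : E * \bar R | C (z.1, fine z.2)].
    by rewrite -[X in measurable X]setTI; exact: mfine.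
  transitivity (law m mPsi [set z | C (z.1, fine z.2)]).
    by rewrite lawE; congr (m _); apply/seteqP; split => -[].
  exact/esym/lawPQ.
move=> mA; apply: eq_probability_prod => // B G mB mG {A mA}.
have mB1 : measurable (B `*` [set: S]) by exact: mXT.
have mB2 : measurable (B `*` [set: R]) by exact: measurableX.
have mR : measurable_fun setT (fun z : E * R => z.2%:E) by exact: measurableT_comp.
have [nu1 nu1E] := restricted_law_exists (mE \x lam)%E mQbar mB1.
have [nu2 nu2E] := restricted_law_exists m mR mB2.
transitivity (nu1 G).
  rewrite nu1E; apply: (congr1 (mE \x lam)%E).
  by apply/seteqP; split => -[e s] /=; tauto.
transitivity (nu2 G); last first.
  rewrite nu2E; apply: (congr1 m).
  by apply/seteqP; split => -[e s] /=; tauto.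
apply: eq_measure_ereal => // [|r]; rewrite nu1E nu2E.
  rewrite !preimage_setT !setIT [LHS]product_measure1E//.
  rewrite [X in (_ * X)%E]probability_setT mule1; congr (m _).
  by apply/seteqP; split => -[e x] //= [].
by rewrite setIC [LHS]VE//; congr (m _); apply/seteqP; split => -[e x] /=; tauto.
Qed.

End transfer_real.

(** * Borel sets of matrices *)

Section borel_matrix.
Context (R : realType) (m n : nat).

Lemma measurable_mx_coord (i : 'I_m) (j : 'I_n) :
  measurable_fun setT (fun M : borel 'M[R]_(m, n) => (M : 'M[R]_(m, n)) i j).
Proof.
apply: (measurability _ (RGenOInfty.measurableE R)) => _ [_ [x ->] <-].
rewrite setTI; apply: sub_sigma_algebra.
apply: (@open_comp _ _ (fun M : 'M[R]_(m, n) => M i j) `]x, +oo[%classic).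
  by move=> M _; exact: coord_continuous.
exact: rray_open.
Qed.

(** For the maximum norm, an open set is the union of the rational boxes it contains, which are
    countably many and are defined coordinate by coordinate. *)
Lemma measurable_mxP d (T : measurableType d) (F : T -> 'M[R]_(m, n)) :
  (forall i j, measurable_fun setT (fun w => F w i j)) ->
  measurable_fun setT (F : T -> borel 'M[R]_(m, n)).
Proof.
move=> mF.
pose box (b : 'M[rat]_(m, n) * rat) :=
  [set M : 'M[R]_(m, n) | forall i j, `|M i j - ratr (b.1 i j)| < ratr b.2].
have mbox b : measurable (F @^-1` box b).
  have -> : F @^-1` box b = \bigcap_(p in [set: 'I_m * 'I_n])
      [set w | `|F w p.1 p.2 - ratr (b.1 p.1 p.2)| < ratr b.2].
    apply/seteqP; split => [w Fw p _|w Fw i j]; first exact: Fw.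
    exact: (Fw (i, j)).
  apply: fin_bigcap_measurable; first exact: finite_finset.
  move=> [i j] _ /=.
  pose g (w : T) : R := `|F w i j - ratr (b.1 i j)|.
  have mg : measurable_fun setT g.
    by apply: measurableT_comp => //; exact: measurable_funB.
  rewrite (_ : mkset _ = g @^-1` `]-oo, ratr b.2[); last first.
    by apply/seteqP; split => w /=; rewrite in_itv.
  by rewrite -[X in measurable X]setTI; exact: mg.
apply: (@measurability _ _ T (borel 'M[R]_(m, n)) setT F
  (@open 'M[R]_(m, n)) erefl) => _ [U oU <-].
rewrite setTI.
have -> : F @^-1` U = \bigcup_(b in [set b | box b `<=` U]) F @^-1` box b.
  apply/seteqP; split => [w /= UFw|w [b /= bU]]; last exact: bU.
  have /nbhs_ballP[e /= e0 eU] : nbhs (F w) U by exact: open_nbhs_nbhs.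
  (* A box of half-width [r] whose rational center is within [r] of [F w] stays in the ball of
     radius [2 * r < e]. *)
  have e20 : 0 < e / 2 by rewrite divr_gt0.
  have [r /[!in_itv]/= /andP[r0 re]] := rat_in_itvoo e20.
  have /choice[q qP] : forall p : 'I_m * 'I_n, exists q : rat,
      `|F w p.1 p.2 - ratr q| < ratr r.
    move=> [i j] /=.
    have rr : F w i j - ratr r < F w i j + ratr r by lra.
    have [q /[!in_itv]/= /andP[q1 q2]] := rat_in_itvoo rr.
    by exists q; rewrite ltr_norml; apply/andP; split; lra.
  exists (\matrix_(i, j) q (i, j), r) => /=.
    move=> M bM; apply: eU; split => // i j.
    rewrite /ball/=; have := bM i j; have := qP (i, j); rewrite mxE/=.
    by rewrite !ltr_norml => /andP[? ?] /andP[? ?]; apply/andP; split; lra.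
  by move=> i j /=; rewrite mxE; exact: (qP (i, j)).
rewrite bigcup_mkcond; apply: countable_bigcupT_measurable => // b.
by case: ifPn.
Qed.

End borel_matrix.

Section transfers.
Context (R : realType).

Lemma transfers_retract d1 d2 (Z1 : measurableType d1) (Z2 : measurableType d2)
    (f : Z1 -> Z2) (g : Z2 -> Z1) :
  measurable_fun setT f -> measurable_fun setT g -> cancel f g ->
  transfers R Z2 -> transfers R Z1.
Proof.
move=> mf mg fg tr dE E m.
have mF : measurable_fun setT (fun z : E * Z1 => (z.1, f z.2)).
  by apply: measurable_fun_pair => //; exact: measurableT_comp.
have mG : measurable_fun setT (fun z : E * Z2 => (z.1, g z.2)).
  by apply: measurable_fun_pair => //; exact: measurableT_comp.
have [dS [S [lam [Q [mQ QE]]]]] := tr _ E (law m mF).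
exists dS, S, lam, (g \o Q); split; first exact: measurableT_comp.
move=> C mC; have mC' : measurable [set z : E * Z2 | C (z.1, g z.2)].
  by rewrite -[X in measurable X]setTI; exact: mG.
have := QE _ mC'; rewrite lawE (_ : _ @^-1` _ = C)//.
by apply/seteqP; split => -[e z]/=; rewrite fg.
Qed.

Lemma transfers_unit d (Z : measurableType d) (z0 : Z) :
  (forall z, z = z0) -> transfers R Z.
Proof.
(* Any noise works here; [E] with its marginal law is a probability space at hand. *)
move=> zz0 dE E m; exists _, E, (law m (@measurable_fst _ _ E Z)), (fun=> z0).
split=> // C mC.
have mC1 : measurable [set e | C (e, z0)].
  have -> : [set e | C (e, z0)] = ysection C z0.
    by apply/seteqP; split => e; rewrite /ysection/= inE.
  exact: measurable_ysection.
have -> : [set z : E * E | C (z.1, z0)] = [set e | C (e, z0)] `*` setT.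
  by apply/seteqP; split => -[e e'] //= [].
rewrite [RHS]product_measure1E// [X in (_ * X)%E]probability_setT mule1.
by apply: (congr1 m); apply/seteqP; split => -[e z] /=; rewrite (zz0 z).
Qed.

(** The first component is resampled given [E], then the second given [E] and the resampled first
    component, with two independent noises; Tonelli's theorem recombines them. *)
Lemma transfers_prod d1 d2 (Z1 : measurableType d1) (Z2 : measurableType d2) :
  transfers R Z1 -> transfers R Z2 -> transfers R (Z1 * Z2)%type.
Proof.
move=> tr1 tr2 dE E m.
have m1 : measurable_fun setT (fun z : E * (Z1 * Z2) => (z.1, z.2.1)).
  apply: measurable_fun_pair => //.
  exact: measurableT_comp (@measurable_fst _ _ Z1 Z2) measurable_snd.
have m2 : measurable_fun setT (fun z : E * (Z1 * Z2) => ((z.1, z.2.1), z.2.2)).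
  apply: measurable_fun_pair => //.
  exact: measurableT_comp (@measurable_snd _ _ Z1 Z2) measurable_snd.
have m3 : measurable_fun setT (fun z : E * Z1 * Z2 => (z.1.1, (z.1.2, z.2))).
  apply: measurable_fun_pair.
    exact: measurableT_comp measurable_fst measurable_fst.
  apply: measurable_fun_pair => //.
  exact: measurableT_comp measurable_snd measurable_fst.
have [d3 [S1 [lam1 [Q1 [mQ1 Q1E]]]]] := tr1 _ E (law m m1).
have [d4 [S2 [lam2 [Q2 [mQ2 Q2E]]]]] := tr2 _ (E * Z1)%type (law m m2).
have mp1 : measurable_fun setT (fun z : E * (S1 * S2) => (z.1, z.2.1)).
  apply: measurable_fun_pair => //.
  exact: measurableT_comp (@measurable_fst _ _ S1 S2) measurable_snd.
have mR1 : measurable_fun setT (fun z : E * (S1 * S2) => Q1 (z.1, z.2.1)).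
  exact: measurableT_comp mQ1 mp1.
have mR2 : measurable_fun setT
    (fun z : E * (S1 * S2) => Q2 ((z.1, Q1 (z.1, z.2.1)), z.2.2)).
  apply: (measurableT_comp mQ2); apply: measurable_fun_pair => //.
    exact: measurable_fun_pair.
  exact: measurableT_comp (@measurable_snd _ _ S1 S2) measurable_snd.
exists _, (S1 * S2)%type, (lam1 \x lam2)%E,
  (fun z => (Q1 (z.1, z.2.1), Q2 ((z.1, Q1 (z.1, z.2.1)), z.2.2))).
split; first exact: measurable_fun_pair.
move=> C mC; set mE := law m _.
pose C3 : set (E * Z1 * Z2) := [set z | C (z.1.1, (z.1.2, z.2))].
have mC3 : measurable C3 by rewrite -[X in measurable X]setTI; exact: m3.
pose C2 : set (E * Z1 * S2) := [set z | C3 (z.1, Q2 z)].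
have mC2 : measurable C2.
  rewrite /C2 -[X in measurable X]setTI.
  by apply: (measurable_fun_pair (f := fst) (g := Q2)).
pose h (z : E * Z1) := lam2 (xsection C2 z).
have mh : measurable_fun setT h by exact: measurable_fun_xsection.
have mQ1' : measurable_fun setT (fun z : E * S1 => (z.1, Q1 z)).
  exact: measurable_fun_pair.
have lawm2 B : measurable B -> law (law m m2) (@measurable_fst _ _ (E * Z1)%type Z2) B =
    law (mE \x lam1)%E mQ1' B.
  by move=> mB; exact: Q1E.
transitivity (\int[law (law m m2) (@measurable_fst _ _ (E * Z1)%type Z2)]_z h z)%E.
  transitivity (law m m2 C3); last exact: (Q2E _ mC3).
  by apply: (congr1 m); apply/seteqP; split => -[e [z1 z2]].
transitivity (\int[law (mE \x lam1)%E mQ1']_z h z)%E.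
  by apply: eq_measure_integral => B mB _; exact: lawm2.
transitivity (\int[mE \x lam1]_z h (z.1, Q1 z))%E; first exact: ge0_integral_law.
transitivity (\int[mE]_e \int[lam1]_s h (e, Q1 (e, s)))%E.
  by rewrite fubini_tonelli1//; exact: measurableT_comp.
apply: eq_integral => e _; apply: eq_integral => s _; rewrite /h.
congr (lam2 _); apply/seteqP; split => s2.
  by move=> /set_mem Cs2; apply/mem_set/mem_set.
by move=> /set_mem/set_mem Cs2; apply/mem_set.
Qed.

Lemma transfers_row n : transfers R (borel 'rV[R]_n).
Proof.
elim: n => [|n IH].
  by apply: (@transfers_unit _ (borel 'rV[R]_0) (0 : 'rV[R]_0)) => z; exact: thinmx0.
pose f (z : borel 'rV[R]_n.+1) : R * borel 'rV[R]_n :=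
  ((z : 'rV[R]_n.+1) ord0 ord0, \row_j (z : 'rV[R]_n.+1) ord0 (lift ord0 j)).
pose g (z : R * borel 'rV[R]_n) : borel 'rV[R]_n.+1 :=
  \row_j oapp ((z.2 : 'rV[R]_n) ord0) z.1 (unlift ord0 j).
apply: (transfers_retract (f := f) (g := g)).
- apply: measurable_fun_pair; first exact: measurable_mx_coord.
  apply: measurable_mxP => i j; under eq_fun do rewrite mxE.
  exact: measurable_mx_coord.
- apply: measurable_mxP => i j; under eq_fun do rewrite mxE.
  case: (unlift ord0 j) => [j'|] /=; last exact: measurable_fst.
  exact: measurableT_comp (@measurable_mx_coord R 1 n ord0 j') measurable_snd.
- move=> z; apply/rowP => j; rewrite mxE /f/=.
  by case: unliftP => [j' ->|->] /=; rewrite ?mxE.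
apply: transfers_prod => //; exact: transfer_real.
Qed.

End transfers.

(** * Finite martingales *)

Section scenario_tree.
Context (R : realType) (n k T : nat).
Notation path := 'M[R]_(T.+1, n).
Variables (A : set path) (f : path -> 'rV[R]_k).

(** Times are natural numbers, which suits inductions. [inord] sends a time beyond [T] to row 0,
    whence the bounds by [T] in the lemmas. *)
Definition state (w : path) (t : nat) : 'rV[R]_n := row (inord t) w.

Definition set_state (t : nat) (w : path) (z : 'rV[R]_n) : path :=
  \matrix_(i, j) if i == t :> nat then z ord0 j else w i j.

Lemma state_set_state t w z : (t <= T)%N -> state (set_state t w z) t = z.
Proof. by move=> tT; apply/rowP => j; rewrite !mxE inordK// eqxx. Qed.

Lemma state_set_state_neq s t w z : (s <= T)%N -> s != t ->
  state (set_state t w z) s = state w s.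
Proof. by move=> sT st; apply/rowP => j; rewrite !mxE inordK// (negbTE st). Qed.

(* [tree j t w y]: starting from [w] at time [t], [j] martingale steps with
   [(n + k).+1] branches each lead into [A], with mean value [y] of [f]. The
   states of [w] after time [t] are irrelevant, since the steps overwrite them. *)
Fixpoint tree (j t : nat) (w : path) (y : 'rV[R]_k) : Prop :=
  if j is j'.+1 then
    exists (c : 'I_(n + k).+1 -> R) (z : 'I_(n + k).+1 -> 'rV[R]_n)
      (ys : 'I_(n + k).+1 -> 'rV[R]_k),
      [/\ (forall i, 0 <= c i) /\ \sum_i c i = 1, \sum_i c i *: z i = state w t,
          \sum_i c i *: ys i = y &
          forall i, tree j' t.+1 (set_state t.+1 w (z i)) (ys i)]
  else A w /\ f w = y.

(** A combinatorial enlargement of the natural filtration at time [s], as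
    [natural_filtration_prefix] shows. *)
Definition determined_by_prefix (s : nat) (B : set path) :=
  forall w w' : path, (forall r, (r <= s)%N -> state w r = state w' r) -> B w -> B w'.

(** The martingale increment is tested on past events, not node by node: different nodes may carry
    the same prefix, and the sums over events are insensitive to such coincidences. *)
Definition balanced (l : seq (R * path)) (s : nat) :=
  forall B, determined_by_prefix s B ->
    \sum_(p <- l) (p.1 * \1_B p.2) *: (state p.2 s.+1 - state p.2 s) = 0.

Lemma indic_prefix s B (w w' : path) : determined_by_prefix s B ->
  (forall r, (r <= s)%N -> state w r = state w' r) -> \1_B w = \1_B w' :> R.
Proof.
move=> Bs ww'; rewrite !indicE; congr (_%:R); congr nat_of_bool.
by apply/idP/idP => /set_mem Bw; apply/mem_set; apply: Bs Bw => r /ww'.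
Qed.

(** Weights multiply along the branches, so increments after the root step inherit their balance
    from each subtree. *)
Lemma tree_paths j t w y : (t + j = T)%N -> tree j t w y ->
  exists l : seq (R * path),
    [/\ size l = ((n + k + 1) ^ j)%N,
        (forall p, p \in l -> [/\ 0 <= p.1, A p.2 &
          forall r, (r <= t)%N -> state p.2 r = state w r]),
        \sum_(p <- l) p.1 = 1,
        \sum_(p <- l) p.1 *: f p.2 = y &
        forall s, (t <= s < T)%N -> balanced l s].
Proof.
elim: j t w y => [|j IH] t w y.
  rewrite addn0 => -> [Aw fw]; exists [:: (1, w)]; split => //.
  - by move=> p; rewrite inE => /eqP ->.
  - by rewrite big_seq1.
  - by rewrite big_seq1 scale1r.
  - by move=> s /andP[Ts sT]; rewrite ltnNge Ts in sT.
move=> tjT [c [z [ys [[c0 c1] cz cy step]]]].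
have tjT' : (t.+1 + j = T)%N by rewrite addSnnS.
have /choice[L LP] : forall i, exists l : seq (R * path),
    [/\ size l = ((n + k + 1) ^ j)%N,
        (forall p, p \in l -> [/\ 0 <= p.1, A p.2 & forall r, (r <= t.+1)%N ->
          state p.2 r = state (set_state t.+1 w (z i)) r]),
        \sum_(p <- l) p.1 = 1,
        \sum_(p <- l) p.1 *: f p.2 = ys i &
        forall s, (t.+1 <= s < T)%N -> balanced l s].
  by move=> i; exact: IH tjT' (step i).
pose l := flatten [seq [seq (c i * p.1, p.2) | p <- L i] | i <- enum 'I_(n + k).+1].
have sumE (V : lmodType R) (F : R * path -> V) :
    \sum_(p <- l) F p = \sum_i \sum_(p <- L i) F (c i * p.1, p.2).
  rewrite /l big_flatten/= big_map big_enum/=; apply: eq_bigr => i _.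
  by rewrite big_map.
have tT : (t.+1 <= T)%N by rewrite -tjT' leq_addr.
have Lw i p r : p \in L i -> (r <= t)%N -> state p.2 r = state w r.
  have [_ LA _ _ _] := LP i; move=> /LA[_ _ prefix] rt.
  rewrite prefix ?(leqW rt)// state_set_state_neq//.
    by rewrite (leq_trans rt)// ltnW.
  by rewrite ltn_eqF.
exists l; split.
- rewrite size_flatten sumnE /shape 2!big_map big_enum/=.
  under eq_bigr => i _ do [rewrite size_map; have [-> _ _ _ _] := LP i].
  by rewrite sum_nat_const card_ord expnS addn1.
- move=> _ /flattenP[_ /mapP[i _ ->] /mapP[p pL ->]] /=.
  have [_ /(_ _ pL)[p0 Ap _] _ _ _] := LP i; split => //.
    by rewrite mulr_ge0.
  by move=> r rt; exact: Lw pL rt.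
- rewrite (sumE R^o) -[RHS]c1; apply: eq_bigr => i _ /=.
  by have [_ _ l1 _ _] := LP i; rewrite -mulr_sumr l1 mulr1.
- rewrite sumE -[RHS]cy; apply: eq_bigr => i _ /=.
  have [_ _ _ <- _] := LP i; rewrite scaler_sumr.
  by apply: eq_bigr => p _; rewrite scalerA.
move=> s /andP[ts sT] B Bs; rewrite sumE.
have [st|st|{}ts] := ltngtP s t; first by rewrite ltnNge ts in st.
  rewrite big1// => i _ /=; have [_ _ _ _ /(_ s)] := LP i; rewrite st sT.
  move=> /(_ isT B Bs) bal; under eq_bigr do rewrite -mulrA -scalerA.
  by rewrite -scaler_sumr bal scaler0.
(* At the root time all paths share the prefix of [w], so the indicator of [B] is constant and the
   martingale condition of the root cancels the sum. *)
rewrite ts in Bs *; transitivity (\1_B w *: \sum_i c i *: (z i - state w t)).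
  rewrite scaler_sumr; apply: eq_bigr => i _.
  have [_ LA l1 _ _] := LP i.
  transitivity (\sum_(p <- L i) p.1 *: ((c i * \1_B w) *: (z i - state w t))).
    rewrite [LHS]big_seq [RHS]big_seq; apply: eq_bigr => p pL /=.
    have -> : \1_B p.2 = \1_B w :> R by apply: indic_prefix Bs _ => r; exact: Lw pL.
    have [_ _ prefix] := LA _ pL; rewrite prefix// state_set_state//.
    by rewrite (Lw _ _ _ pL)// scalerA; congr (_ *: _); rewrite [RHS]mulrCA mulrA.
  by rewrite -scaler_suml l1 scale1r scalerA mulrC.
under eq_bigr do rewrite scalerBr.
by rewrite sumrB cz -scaler_suml c1 scale1r subrr scaler0.
Qed.

End scenario_tree.

(** * Finitely supported laws *)

Section discrete_measure.
Context d (T : measurableType d) (R : realType).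
Implicit Types (l : seq (R * T)) (nu : {measure set T -> \bar R}).

(** A predicate, so that the integration lemmas serve both for a measure and for its completion. *)
Definition atomic l (nu : set T -> \bar R) :=
  forall A, measurable A -> nu A = (\sum_(p <- l) p.1 * \1_A p.2)%:E.

Let nth_atom l i := nth (0, point) l i.

(** [mscale] takes a scalar that is nonnegative by its type; the absolute value supplies it and is
    harmless for nonnegative weights. *)
Let atoms l (i : nat) : {measure set T -> \bar R} :=
  mscale (NngNum (normr_ge0 (nth_atom l i).1)) \d_((nth_atom l i).2).

Let atomsE l A : (forall p, p \in l -> 0 <= p.1) ->
  msum (atoms l) (size l) A = (\sum_(p <- l) p.1 * \1_A p.2)%:E.
Proof.
move=> l0; rewrite /msum (big_nth (0, point)) big_mkord -sumEFin.
apply: eq_bigr => i _; rewrite /atoms/= /mscale/= /dirac -EFinM.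
by rewrite ger0_norm// l0// mem_nth.
Qed.

Lemma discrete_probability_exists l :
  (forall p, p \in l -> 0 <= p.1) -> \sum_(p <- l) p.1 = 1 ->
  exists nu : probability T R,
    forall A, nu A = (\sum_(p <- l) p.1 * \1_A p.2)%:E.
Proof.
move=> l0 l1; pose nu := msum (atoms l) (size l).
have nuT : nu setT = 1%E.
  rewrite /nu atomsE// -l1; congr EFin; apply: eq_bigr => p _.
  by rewrite indicT mulr1.
pose nu_prob := Measure_isProbability.Build _ _ _ nu nuT.
pose nuP : probability T R := HB.pack nu nu_prob.
by exists nuP => A; rewrite -[LHS]/(nu A) /nu atomsE.
Qed.

Let ge0_integral_atomic l nu D (g : T -> R) : (forall p, p \in l -> 0 <= p.1) ->
  atomic l nu -> measurable D -> measurable_fun setT g -> (forall x, 0 <= g x) ->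
  (\int[nu]_(x in D) (g x)%:E = (\sum_(p <- l) p.1 * (\1_D p.2 * g p.2))%:E)%E.
Proof.
move=> l0 nul mD mg g0.
have mgE : measurable_fun D (EFin \o g) by exact/measurable_EFinP/measurable_funTS.
rewrite (eq_measure_integral (msum (atoms l) (size l))); last first.
  by move=> A mA _; rewrite nul// [RHS]atomsE.
rewrite ge0_integral_measure_sum//; last by move=> x _; rewrite lee_fin.
rewrite (big_nth (0, point)) big_mkord -sumEFin; apply: eq_bigr => i _.
rewrite ge0_integral_mscale//; last by move=> x _; rewrite lee_fin.
rewrite integral_dirac// diracE -/(nth_atom l i) EFinM/= ger0_norm; last first.
  by rewrite l0// mem_nth.
by rewrite indicE EFinM.
Qed.

(** Any real function is its absolute value minus a nonnegative function, which reduces the claim to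
    the nonnegative case. *)
Lemma integral_atomic l nu D (g : T -> R) : (forall p, p \in l -> 0 <= p.1) ->
  atomic l nu -> measurable D -> measurable_fun setT g ->
  nu.-integrable setT (EFin \o g) /\
  (\int[nu]_(x in D) (g x)%:E = (\sum_(p <- l) p.1 * (\1_D p.2 * g p.2))%:E)%E.
Proof.
move=> l0 nul mD mg.
have ge0_integrable (h : T -> R) : measurable_fun setT h -> (forall x, 0 <= h x) ->
    nu.-integrable setT (EFin \o h).
  move=> mh h0; apply/integrableP; split; first exact/measurable_EFinP.
  under eq_integral do rewrite /= ger0_norm//.
  by rewrite (ge0_integral_atomic l0 nul)// ltry.
have mg1 : measurable_fun setT (fun x => `|g x|) by exact: measurableT_comp.
have mg2 : measurable_fun setT (fun x => `|g x| - g x) by exact: measurable_funB.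
have g1 x : 0 <= `|g x| by [].
have g2 x : 0 <= `|g x| - g x by rewrite subr_ge0 ler_norm.
have i1 := ge0_integrable _ mg1 g1; have i2 := ge0_integrable _ mg2 g2.
have gE x : (g x)%:E = (`|g x|%:E - (`|g x| - g x)%:E)%E.
  by rewrite -EFinB opprB addrC subrK.
split.
  have -> : EFin \o g = (fun x => `|g x|%:E - (`|g x| - g x)%:E)%E.
    by apply/funext => x; exact: gE.
  exact: integrableB.
under eq_integral do rewrite gE.
rewrite integralB//; [|exact: integrableS i1|exact: integrableS i2].
rewrite !(ge0_integral_atomic l0 nul)// -EFinB -sumrB; congr EFin.
by apply: eq_bigr => p _; rewrite -mulrBr -mulrBr opprB addrC subrK.
Qed.

End discrete_measure.

Lemma measurable_normv d (W : measurableType d) (R : realType) k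
    (f : W -> 'rV[R]_k) :
  measurable_fun setT (f : W -> borel 'rV[R]_k) ->
  measurable_fun setT (fun w => `|f w|).
Proof.
move=> mf.
have mn : measurable_fun setT (fun v : borel 'rV[R]_k => `|v : 'rV[R]_k|).
  apply: (measurability _ (RGenOInfty.measurableE R)) => _ [_ [x ->] <-].
  rewrite setTI; apply: sub_sigma_algebra.
  apply: (@open_comp _ _ (fun v : 'rV[R]_k => `|v|) `]x, +oo[%classic).
    by move=> v _; exact: norm_continuous.
  exact: rray_open.
exact: (measurableT_comp mn mf).
Qed.

Section discrete_vintegral.
Context d (W : measurableType d) (R : realType) (nu : {measure set W -> \bar R}).
Variable l : seq (R * W).
Hypotheses (l0 : forall p, p \in l -> 0 <= p.1) (nul : atomic l nu).

Lemma vintegrable_atomic k (f : W -> 'rV[R]_k) :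
  measurable_fun setT (f : W -> borel 'rV[R]_k) -> vintegrable nu f.
Proof.
move=> mf; split => //; have mn := measurable_normv mf.
by rewrite (integral_atomic l0 nul _ mn).2// ltry.
Qed.

Lemma vintegral_atomic k D (f : W -> 'rV[R]_k) : measurable D ->
  measurable_fun setT (f : W -> borel 'rV[R]_k) ->
  vintegral nu D f = \sum_(p <- l) (p.1 * \1_D p.2) *: f p.2.
Proof.
move=> mD mf; apply/rowP => j; rewrite mxE summxE.
have mfj : measurable_fun setT (fun w => f w ord0 j).
  exact: (measurableT_comp (measurable_mx_coord ord0 j) mf).
rewrite /Rintegral (integral_atomic l0 nul mD mfj).2/=.
by apply: eq_bigr => p _; rewrite mxE mulrA.
Qed.

End discrete_vintegral.

Section discrete_martingale.
Context (R : realType) (n T : nat).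
Notation path := (paths R n T).

Lemma measurable_coordinate (t : 'I_T.+1) :
  measurable_fun setT (@coordinate R n T t : path -> borel 'rV[R]_n).
Proof.
apply: measurable_mxP => i j; under eq_fun do rewrite mxE.
exact: measurable_mx_coord.
Qed.

Lemma coordinateE (t : 'I_T.+1) (w : path) : coordinate t w = state w t.
Proof. by rewrite /coordinate /state inord_val. Qed.

Lemma natural_filtration_measurable (t : 'I_T.+1) (B : set path) :
  natural_filtration (@coordinate R n T) t B -> measurable B.
Proof.
move: B; apply: smallest_sub; first exact: sigma_algebra_measurable.
by move=> _ [s _ [C mC <-]]; exact: measurable_coordinate.
Qed.

(** Sets determined by a prefix form a sigma-algebra; closure under complement comes from the
    symmetry of agreement up to [t]. *)
Lemma natural_filtration_prefix (t : 'I_T.+1) (B : set path) :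
  natural_filtration (@coordinate R n T) t B -> determined_by_prefix t B.
Proof.
pose det := [set B : set path | determined_by_prefix t B].
suff : natural_filtration (@coordinate R n T) t `<=` det by exact.
apply: smallest_sub => [|_ [s /= st [C mC <-]] w w' ww' [_ Cw]]; last first.
  by split => //; move: Cw; rewrite /= !coordinateE ww'.
split => [//|B' detB w w' ww'|F detF w w' ww' [i _ Fiw]].
- rewrite setTD => Bw B'w'; apply: Bw; apply: detB B'w' => r rt.
  by rewrite ww'.
- by exists i => //; exact: detF Fiw.
Qed.

Lemma determined_by_prefixW s t (B : set path) : (s <= t)%N ->
  determined_by_prefix s B -> determined_by_prefix t B.
Proof.
by move=> st Bs w w' ww'; apply: Bs => r rs; exact/ww'/(leq_trans rs).
Qed.

Lemma discrete_martingale_law (l : seq (R * path)) (nu : probability path R) x0 :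
  (forall p, p \in l -> 0 <= p.1 /\ state p.2 0 = x0) -> atomic l nu ->
  (forall s, (s < T)%N -> balanced l s) ->
  martingale_law x0 nu.
Proof.
move=> lP nul bal.
have l0 p : p \in l -> 0 <= p.1 by move=> /lP[].
split; last first.
  have mx0 : measurable [set w : path | coordinate ord0 w <> x0].
    have -> : [set w : path | coordinate ord0 w <> x0] =
        \bigcup_(j in [set: 'I_n]) [set w : path | w ord0 j != x0 ord0 j].
      apply/seteqP; split => [w /= wx|w [j _ /= wj] wx]; last first.
        by move/eqP: wj; apply; rewrite -wx mxE.
      apply: contrapT => wx0; apply: wx; apply/rowP => j; rewrite mxE.
      by apply/eqP; apply: contrapT => /negP wj; apply: wx0; exists j.
    apply: fin_bigcup_measurable => // j _.
    rewrite -[X in measurable X]setTI.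
    have := measurable_mx_coord (m := T.+1) (n := n) (R := R) ord0 j.
    move=> /(_ measurableT [set~ x0 ord0 j]).
    set C := _ `&` _; set C' := _ `&` _; have -> : C = C'.
      by apply/seteqP; split => w [_ /=]; [split => //; exact/eqP|split => //; exact/eqP].
    apply; exact: measurableC.
  exists [set w : path | coordinate ord0 w <> x0]; split => //.
  rewrite nul// big_seq big1// => p /lP[_ px0].
  by rewrite indicE memNset ?mulr0// => /=; rewrite coordinateE px0.
have mcoord := measurable_coordinate.
split => [t|s t st]; first exact: (vintegrable_atomic l0 nul (mcoord _)).
split.
- by move=> B FB; apply: sub_sigma_algebra; exists s => /=.
- exact: (vintegrable_atomic l0 nul (mcoord _)).
move=> B FB; have mB := natural_filtration_measurable FB.
rewrite !(vintegral_atomic l0 nul mB)//.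
under eq_bigr do rewrite coordinateE.
under [RHS]eq_bigr do rewrite coordinateE.
have Bs := natural_filtration_prefix FB.
have stT : (t <= T)%N by rewrite -ltnS.
(* The increments between [s] and [t] are removed one at a time: an event determined by the prefix
   up to [s] is also determined by every longer prefix. *)
elim: {t}(t : nat) st stT => [|t IH] st tT.
  by move: st; rewrite leqn0 => /eqP ->.
move: st; rewrite leq_eqVlt => /predU1P[->//|st].
rewrite IH//; last exact: ltnW.
apply/esym/eqP; rewrite -subr_eq0 -sumrB; apply/eqP.
rewrite -[RHS](bal t tT B (determined_by_prefixW _ Bs))//.
by apply: eq_bigr => p _; rewrite scalerBr.
Qed.

End discrete_martingale.

Section discrete_completion.
Context (R : realType) (n T : nat).
Notation path := (paths R n T).
Variables (l : seq (R * path)) (nu : probability path R).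
Hypotheses (l0 : forall p, p \in l -> 0 <= p.1) (nul : atomic l nu).

Let W : set path := [set` map snd l].

Let finite_closed (A : set 'M[R]_(T.+1, n)) : finite_set A -> closed A.
Proof.
apply: (iffLR accessible_finite_set_closed).
exact: hausdorff_accessible (@norm_hausdorff R 'M[R]_(T.+1, n)).
Qed.

Let finW : finite_set W.
Proof. exact: finite_seq. Qed.

Let openCW : open (~` (W : set 'M[R]_(T.+1, n))).
Proof. by apply: closed_openC; apply: finite_closed; exact: finW. Qed.

Let measurable_fin (A : set path) : A `<=` W -> measurable A.
Proof.
move=> AW; rewrite -[A]setCK; apply: measurableC; apply: sub_sigma_algebra.
apply: closed_openC; apply: finite_closed.
exact: sub_finite_set AW finW.
Qed.

Let measurableCW : measurable (~` W).
Proof. by apply: measurableC; apply: measurable_fin. Qed.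

Let nuCW : nu (~` W) = 0%E.
Proof.
rewrite nul; last exact: measurableCW.
rewrite big_seq big1// => p pl; rewrite indicE memNset ?mulr0//= => nW; apply: nW.
by apply/mapP; exists p.
Qed.

Lemma atomic_support : measure_support nu `<=` [set` map snd l].
Proof.
move=> w ws; apply: contrapT => Ww.
by have := ws _ openCW Ww; rewrite nuCW ltxx.
Qed.

(** Any set is a finite set of atoms plus a part of the null complement of [W]. This is why [f],
    measurable only for [mu], is measurable for the completion of [nu]. *)
Lemma measurable_completion_atomic (A : set (completion nu)) : measurable A.
Proof.
apply: sub_sigma_algebra; exists (A `&` W); first exact: measurable_fin.
exists (A `\` W); last by rewrite setUIDK.
by exists (~` W); split => // w [].
Qed.

Lemma completed_atomic :
  atomic (l : seq (R * completion nu)) (completed_measure nu).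
Proof.
suff nuA (A : set path) :
    completed_measure nu A = (\sum_(p <- l) p.1 * \1_A p.2)%:E.
  by move=> A _; exact: nuA.
have mAW : measurable (A `&` W) by exact: measurable_fin.
have mCW := measurableCW.
transitivity (nu (A `&` W)); last first.
  rewrite nul// big_seq [in RHS]big_seq; congr EFin; apply: eq_bigr => p pl.
  rewrite !indicE in_setI (_ : p.2 \in W) ?andbT//.
  by apply/mem_set; exact: map_f.
rewrite -[RHS]measurable_mu_extE//.
(* The outer measure of [A] is squeezed between those of its trace on [W] and of this trace enlarged
   by the null set outside [W]. *)
apply/eqP; rewrite eq_le; apply/andP; split; last first.
  by apply: le_outer_measure; exact: subIsetl.
have : ((nu^*)%mu A <= (nu^*)%mu ((A `&` W) `|` ~` W))%E.
  by apply: le_outer_measure => w Aw; have [Ww|Ww] := pselect (W w); [left|right].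
move=> /le_trans; apply; apply: (le_trans (outer_measureU2 _ _ _)).
have nuW0 : (nu^*)%mu (~` W) = 0%E.
  by rewrite -[RHS]nuCW; exact: measurable_mu_extE.
by rewrite -[leRHS]adde0 leeD// [leLHS]nuW0.
Qed.

End discrete_completion.

(** * Completion *)

Section completion_theory.
Context d (T : measurableType d) (R : realType) (mu : probability T R).

Lemma completion_measurableP (A : set (completion mu)) : measurable A ->
  exists B N : set T, [/\ measurable B, measurable N, mu N = 0%E &
    forall x, ~ N x -> A x <-> B x].
Proof.
pose G := [set A : set T | exists B N : set T, [/\ measurable B, measurable N,
  mu N = 0%E & forall x, ~ N x -> A x <-> B x]].
suff : measurable `<=` (G : set (set (completion mu))) by exact.
apply: smallest_sub => [|_ [B mB [M [N [mN N0 MN]] <-]]]; last first.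
  exists B, N; split => // x Nx; split; last by left.
  by case => // /MN.
split=> [|A' [B [N [mB mN N0 AB]]]|F FG].
- by exists set0, set0; split => //; rewrite measure0.
- exists (~` B), N; split => //; first exact: measurableC.
  by move=> x Nx; rewrite setTD; have := AB _ Nx; rewrite /setC/=; tauto.
- have /choice[BN BNP] : forall i, exists BN : set T * set T,
      [/\ measurable BN.1, measurable BN.2, mu BN.2 = 0%E &
        forall x, ~ BN.2 x -> F i x <-> BN.1 x].
    by move=> i; have [B [N ?]] := FG i; exists (B, N).
  exists (\bigcup_i (BN i).1), (\bigcup_i (BN i).2); split.
  + by apply: bigcupT_measurable => i; have [] := BNP i.
  + by apply: bigcupT_measurable => i; have [] := BNP i.
  + apply/eqP; rewrite -measure_le0.
    have mBN i : measurable (BN i).2 by have [] := BNP i.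
    have := generalized_Boole_inequality mu mBN (bigcupT_measurable _ mBN).
    by rewrite eseries0// => i _ _; have [] := BNP i.
  + move=> x Nx; split => -[i _ Fi]; exists i => //;
      have [_ _ _ FB] := BNP i; apply/FB => // Ni; apply: Nx; by exists i.
Qed.

Lemma completed_measureE (B : set T) : measurable B ->
  completed_measure mu B = mu B.
Proof. exact: measurable_mu_extE. Qed.

Lemma measurable_to_completion : measurable_fun setT (id : completion mu -> T).
Proof.
move=> _ B mB; rewrite setTI; apply: sub_sigma_algebra; exists B => //.
by exists set0; [exact: negligible_set0|rewrite setU0].
Qed.

Lemma ae_completion (P : set T) : {ae mu, forall x, P x} ->
  {ae completed_measure mu, forall x, P x}.
Proof.
move=> [N [mN N0 PN]]; exists N; split => //.
  by have := measurable_to_completion measurableT mN; rewrite setTI.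
by rewrite [LHS]completed_measureE.
Qed.

Lemma ae_of_completed_measure1 (A : set (completion mu)) : measurable A ->
  completed_measure mu A = 1%E -> {ae mu, forall x, A x}.
Proof.
move=> mA A1; have [B [N [mB mN N0 AB]]] := completion_measurableP mA.
have mBN : measurable (B `|` N) by exact: measurableU.
exists (~` (B `|` N) `|` N); split.
- by apply: measurableU => //; exact: measurableC.
- rewrite measureU0//; last exact: measurableC.
  rewrite [LHS]probability_setC//.
  suff -> : mu (B `|` N) = 1%E by rewrite subee.
  apply/eqP; rewrite eq_le probability_le1//= -A1 -completed_measureE//.
  apply: le_outer_measure => x Ax; have [Nx|Nx] := pselect (N x); [by right|left].
  exact/AB.
- move=> x /= Ax; have [Nx|Nx] := pselect (N x); [by right|left].
  by case=> // Bx; apply: Ax; apply/AB.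
Qed.

(** Each rational sublevel set is replaced by a Borel set equal to it off a null set. Off the
    countable union of these null sets, [cut] recovers [h] from the Borel sets. *)
Lemma completion_measurable_fun (h : T -> R) :
  measurable_fun setT (h : completion mu -> R) ->
  exists2 h' : T -> R, measurable_fun setT h' & {ae mu, forall x, h x = h' x}.
Proof.
move=> mh.
have /choice[BN BNP] : forall q : rat, exists BN : set T * set T,
    [/\ measurable BN.1, measurable BN.2, mu BN.2 = 0%E &
      forall x, ~ BN.2 x -> h x < ratr q <-> BN.1 x].
  move=> q; have mhq : measurable [set x : completion mu | h x < ratr q].
    have := mh measurableT `]-oo, ratr q[%classic (measurable_itv _).
    rewrite setTI; congr measurable; apply/seteqP; split => x /=; by rewrite in_itv.
  by have [B [N ?]] := completion_measurableP mhq; exists (B, N).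
pose c := cut R (fun q => (BN q).1).
exists (fine \o c).
  apply: measurableT_comp => //.
  by apply: measurable_cut => q; have [] := BNP q.
have : {ae mu, forall x, forall q, ~ (BN q).2 x}.
  apply: ae_forall_countable => q; have [_ mN N0 _] := BNP q.
  by exists (BN q).2; split => // x /= /contrapT.
apply: filterS => x Nx /=; rewrite /c (cut_fin (r := h x))// => q.
by have [_ _ _ /(_ _ (Nx q)) hB] := BNP q; split => /hB.
Qed.

Lemma integral_completion (g : T -> \bar R) : measurable_fun setT g ->
  (completed_measure mu).-integrable setT g ->
  mu.-integrable setT g /\
  (\int[completed_measure mu]_x g x = \int[mu]_x g x)%E.
Proof.
move=> mg /[dup] intg /integrableP[_ ig].
have eq_mu A : measurable A -> A `<=` setT ->
    mu A = pushforward (completed_measure mu) (id : completion mu -> T) A.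
  by move=> mA _; rewrite -[LHS]completed_measureE.
have mid := measurable_to_completion.
split.
  apply/integrableP; split => //.
  rewrite (eq_measure_integral _ eq_mu) ge0_integral_pushforward//.
  exact: measurableT_comp.
by rewrite [RHS](eq_measure_integral _ eq_mu) integral_pushforward.
Qed.

End completion_theory.

Lemma coord_le_norm (R : realType) k (v : 'rV[R]_k) j : `|v ord0 j| <= `|v|.
Proof.
rewrite [leRHS]mx_normrE.
by apply: (le_trans _ (le_bigmax _ _ (ord0, j))).
Qed.

Lemma vintegrable_coord d (W : measurableType d) (R : realType)
    (mu : {measure set W -> \bar R}) k (f : W -> 'rV[R]_k) j :
  vintegrable mu f -> mu.-integrable setT (fun w => (f w ord0 j)%:E).
Proof.
move=> [mf foo].
have mfj : measurable_fun setT (fun w => f w ord0 j).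
  exact: (measurableT_comp (measurable_mx_coord ord0 j) mf).
apply/integrableP; split; first exact/measurable_EFinP.
apply: le_lt_trans foo; apply: ge0_le_integral => //.
- exact/measurable_EFinP/measurableT_comp.
- exact/measurable_EFinP/measurable_normv.
- by move=> w _; rewrite lee_fin coord_le_norm.
Qed.

(** The backward induction pushes laws forward and applies Fubini, which calls for a Borel
    function. *)
Lemma borel_version d (W : measurableType d) (R : realType)
    (mu : probability W R) k (f : W -> 'rV[R]_k) :
  vintegrable (completed_measure mu) f ->
  exists f' : W -> 'rV[R]_k,
    [/\ measurable_fun setT (f' : W -> borel 'rV[R]_k),
        {ae mu, forall w, f w = f' w},
        forall j, mu.-integrable setT (fun w => (f' w ord0 j)%:E) &
        vintegral (completed_measure mu) setT f =
          \row_j fine (\int[mu]_w (f' w ord0 j)%:E)%E].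
Proof.
move=> intf.
have mfj j : measurable_fun setT (fun w : completion mu => f w ord0 j).
  exact: (measurableT_comp (measurable_mx_coord ord0 j) intf.1).
have /choice[h hP] : forall j, exists h : W -> R,
    measurable_fun setT h /\ {ae mu, forall w, f w ord0 j = h w}.
  by move=> j; have [h] := completion_measurable_fun (mfj j); exists h.
have mh j : measurable_fun setT (h j) by have [] := hP j.
have fh j : ae_eq (completed_measure mu) setT
    (fun w => (f w ord0 j)%:E) (EFin \o h j).
  apply: ae_completion; have [_] := hP j; apply: filterS => w fw _ /=.
  by rewrite fw.
have mhc j : measurable_fun setT (h j : completion mu -> R).
  exact: (measurableT_comp (mh j) (@measurable_to_completion _ _ _ mu)).
have inth j : (completed_measure mu).-integrable setT (EFin \o h j).
  apply/integrableP; split; first exact/measurable_EFinP.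
  have /integrableP[_] := vintegrable_coord j intf.
  rewrite (@ge0_ae_eq_integral _ _ _ _ _ _ (fun w : completion mu => `|(h j w)%:E|%E))//.
  - by apply: measurableT_comp => //; exact/measurable_EFinP.
  - by apply: measurableT_comp => //; exact/measurable_EFinP.
  - apply: ae_completion; have [_] := hP j; apply: filterS => w fw _ /=.
    by rewrite fw.
have mhE j : measurable_fun setT (EFin \o h j) by exact/measurable_EFinP.
have inth' j := integral_completion (mhE j) (inth j).
exists (fun w => \row_j h j w); split.
- by apply: measurable_mxP => i j; under eq_fun do rewrite mxE; exact: mh.
- have : {ae mu, forall w, forall j, f w ord0 j = h j w}.
    by apply: ae_forall_countable => j; have [] := hP j.
  by apply: filterS => w fw; apply/rowP => j; rewrite mxE.
- move=> j; under eq_fun do rewrite mxE.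
  exact: (inth' j).1.
apply/rowP => j; rewrite !mxE; congr fine.
under [RHS]eq_integral do rewrite mxE.
rewrite -(inth' j).2.
by apply: ae_eq_integral => //; exact/measurable_EFinP.
Qed.

(** * Backward induction on time *)

Section same_law.
Context d1 d2 (X : measurableType d1) (Y : measurableType d2) (R : realType).
Variables (P : probability X R) (m : probability Y R) (phi : X -> Y).
Hypothesis mphi : measurable_fun setT phi.
Hypothesis mP : forall D, measurable D -> m D = P (phi @^-1` D).

Let eq_law D : measurable D -> D `<=` setT -> m D = law P mphi D.
Proof. by move=> mD _; exact: mP. Qed.

(** [transfers] yields a measure that agrees with an image law on measurable sets only, hence these
    variants of the lemmas on [law]. *)
Lemma integrable_same_law (g : Y -> \bar R) : measurable_fun setT g ->
  m.-integrable setT g <-> P.-integrable setT (g \o phi).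
Proof.
move=> mg; apply: iff_trans (integrable_law P mphi mg).
by split=> /integrableP[_ ig]; apply/integrableP; split => //;
  move: ig; rewrite (eq_measure_integral _ eq_law).
Qed.

Lemma integral_same_law (g : Y -> \bar R) D : measurable D ->
  m.-integrable setT g ->
  (\int[m]_(y in D) g y = \int[P]_(x in phi @^-1` D) g (phi x))%E.
Proof.
move=> mD ig; rewrite (eq_measure_integral (law P mphi)); last first.
  by move=> B mB _; exact: eq_law.
apply: integral_law => //; have mg := measurable_int _ ig.
by apply/(integrable_law P mphi mg)/integrable_same_law.
Qed.

Lemma ae_same_law (Q : set Y) : {ae m, forall y, Q y} ->
  {ae P, forall x, Q (phi x)}.
Proof.
move=> [N [mN N0 QN]]; exists (phi @^-1` N); split.
- by rewrite -[X in measurable X]setTI; exact: mphi.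
- by rewrite -mP.
- by move=> x /= Qx; exact: QN.
Qed.

End same_law.

Lemma ae_section d1 d2 (X : measurableType d1) (Y : measurableType d2)
    (R : realType) (P1 : probability X R) (P2 : probability Y R) (Q : set (X * Y)) :
  {ae (P1 \x P2)%E, forall z, Q z} ->
  {ae P1, forall x, {ae P2, forall y, Q (x, y)}}.
Proof.
move=> [N [mN N0 QN]].
have mxN : measurable_fun setT (P2 \o xsection N) by exact: measurable_fun_xsection.
have : ae_eq P1 setT (P2 \o xsection N) (cst 0%E).
  apply/ae_eq_integral_abs => //.
  by rewrite -[RHS]N0; apply: eq_integral => x _; rewrite gee0_abs.
apply: filterS => x /(_ I) /= xN0; exists (xsection N x); split => //.
  exact: measurable_xsection.
by move=> y /= Qy; apply/mem_set; exact: QN.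
Qed.

(** The partial integral given by Fubini is extended-valued, whereas the value carried by a tree is
    real; the two differ on a null set. *)
Lemma integrable_fine d (X : measurableType d) (R : realType)
    (mu : {measure set X -> \bar R}) (g : X -> \bar R) :
  mu.-integrable setT g ->
  mu.-integrable setT (fun x => (fine (g x))%:E) /\
  (\int[mu]_x (fine (g x))%:E = \int[mu]_x g x)%E.
Proof.
move=> ig; have mg := measurable_int _ ig.
have mfg : measurable_fun setT (fun x => (fine (g x))%:E).
  by apply/measurable_EFinP; exact: measurableT_comp.
split.
  apply: (le_integrable measurableT mfg _ ig) => x _.
  by case: (g x) => [r| |] //=; rewrite normr0 leey.
apply: ae_eq_integral => //.
by apply: filterS (integrable_ae measurableT ig) => x /(_ I) /fineK.
Qed.

Section stopped_paths.
Context (R : realType) (n T : nat).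
Notation path := (paths R n T).

(** Zeroing the later rows places the past up to any time in the same space [path], so the induction
    has one type for all times. *)
Definition stop (t : nat) (w : path) : path :=
  \matrix_(i, j) if (i <= t)%N then (w : 'M[R]_(T.+1, n)) i j else 0.

Lemma state_stop t w : (t <= T)%N -> state (stop t w) t = state w t.
Proof. by move=> tT; apply/rowP => j; rewrite !mxE inordK// leqnn. Qed.

Lemma stop_max w : stop T w = w.
Proof. by apply/matrixP => i j; rewrite mxE -ltnS ltn_ord. Qed.

Lemma stopS t w : (t < T)%N ->
  set_state t.+1 (stop t w) (state w t.+1) = stop t.+1 w.
Proof.
move=> tT; apply/matrixP => i j; rewrite !mxE [in RHS]leq_eqVlt ltnS.
by have [it|] := eqVneq (i : nat) t.+1 => //=; rewrite -it inord_val.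
Qed.

Lemma measurable_stop t : measurable_fun setT (stop t).
Proof.
apply: measurable_mxP => i j; under eq_fun do rewrite mxE.
by case: (i <= t)%N; [exact: measurable_mx_coord|exact: measurable_cst].
Qed.

Lemma measurable_state t :
  measurable_fun setT ((fun w => state w t) : path -> borel 'rV[R]_n).
Proof.
apply: measurable_mxP => i j; under eq_fun do rewrite mxE.
exact: measurable_mx_coord.
Qed.

Lemma measurable_state_coord t j :
  measurable_fun setT (fun w : path => state w t ord0 j).
Proof.
exact: measurableT_comp (measurable_mx_coord ord0 j) (measurable_state t).
Qed.

Lemma measurable_set_state t : measurable_fun setT
  ((fun z => set_state t z.1 z.2) : path * borel 'rV[R]_n -> path).
Proof.
apply: measurable_mxP => i j; under eq_fun do rewrite mxE.
case: (i == t :> nat).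
  exact: measurableT_comp (measurable_mx_coord ord0 j) measurable_snd.
exact: measurableT_comp (measurable_mx_coord i j) measurable_fst.
Qed.

(** Events about the stopped path become admissible tests in the martingale property. *)
Lemma stop_natural_filtration (t : 'I_T.+1) (B : set path) : measurable B ->
  natural_filtration (@coordinate R n T) t (stop t @^-1` B).
Proof.
move=> mB; pose G := \bigcup_(s in [set s : 'I_T.+1 | (s <= t)%N])
  preimage_set_system setT (@coordinate R n T s : path -> borel 'rV[R]_n) measurable.
have mstop : measurable_fun setT (stop t : g_sigma_algebraType G -> path).
  apply: measurable_mxP => i j; under eq_fun do rewrite mxE.
  case: (leqP i t) => it; last exact: measurable_cst.
  have mi : measurable_fun setT
      (@coordinate R n T i : g_sigma_algebraType G -> borel 'rV[R]_n).
    by move=> _ C mC; apply: sub_sigma_algebra; exists i => //; exists C.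
  apply: eq_measurable_fun (measurableT_comp (measurable_mx_coord ord0 j) mi).
  by move=> w _; rewrite /= mxE.
by have := mstop measurableT B mB; rewrite setTI.
Qed.

End stopped_paths.

Section backward_induction.
Context (R : realType) (k n T : nat) (x0 : 'rV[R]_n).
Notation path := (paths R n T).
Variable mu : probability path R.
Hypothesis mu_martingale : martingale_law x0 mu.
Variables (A : set path) (f : path -> 'rV[R]_k).

Let mu_ t : probability path R := law mu (@measurable_stop R n T t).

Let state_integrable t j : (t <= T)%N ->
  mu.-integrable setT (fun w => (state w t ord0 j)%:E).
Proof.
move=> tT; have [[vint _] _] := mu_martingale.
have := vintegrable_coord j (vint (inord t)).
by under eq_fun do rewrite coordinateE inordK//.
Qed.

Let martingale_step t (B : set path) j : (t < T)%N -> measurable B ->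
  (\int[mu]_(w in stop t @^-1` B) (state w t.+1 ord0 j)%:E =
   \int[mu]_(w in stop t @^-1` B) (state w t ord0 j)%:E)%E.
Proof.
move=> tT mB; have [[_ mart] _] := mu_martingale.
have mSB : measurable (stop t @^-1` B : set path).
  by rewrite -[X in measurable X]setTI; exact: measurable_stop.
have tT' : (t < T.+1)%N by exact: ltnW.
have [_ _ ce] := mart (Ordinal tT') (Ordinal (tT : (t.+1 < T.+1)%N)) (leqnSn t).
have FB := @stop_natural_filtration R n T (Ordinal tT') B mB.
have /rowP/(_ j) := ce _ FB; rewrite !mxE /Rintegral.
under eq_integral do rewrite coordinateE.
under [in RHS]eq_integral do rewrite coordinateE.
have fin s : (s <= T)%N ->
    (\int[mu]_(w in stop t @^-1` B) (state w s ord0 j)%:E \is a fin_num)%E.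
  move=> sT; apply: integrable_fin_num => //.
  exact: (integrableS measurableT mSB _ (state_integrable j sT)).
by move=> /esym eqf; rewrite -(fineK (fin _ tT)) -(fineK (fin _ (ltnW tT))) eqf.
Qed.

(* The next state, given the path up to time [t], is a function of that path
   and of an independent noise [s]. *)
Let noise_exists t : (t < T)%N ->
  exists dS (S : measurableType dS) (lam : probability S R)
    (Q : path * S -> borel 'rV[R]_n),
  [/\ measurable_fun setT Q,
      forall C : set path, measurable C -> mu_ t.+1 C =
        (mu_ t \x lam)%E [set z | C (set_state t.+1 z.1 (Q z))],
      forall j, (mu_ t \x lam)%E.-integrable setT
        (fun z => ((Q z : 'rV[R]_n) ord0 j)%:E) &
      forall j, {ae mu_ t, forall e, \int[lam]_s ((Q (e, s) : 'rV[R]_n) ord0 j)%:E =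
        (state e t ord0 j)%:E}%E].
Proof.
move=> tT.
have mX : measurable_fun setT (fun w : path =>
    ((stop t w, state w t.+1) : path * borel 'rV[R]_n)).
  apply: measurable_fun_pair; first exact: measurable_stop.
  exact: measurable_state.
pose m := law mu mX.
have [dS [S [lam [Q [mQ QE]]]]] := @transfers_row R n _ path m.
pose mul : probability (path * S)%type R := (mu_ t \x lam)%E.
have mPsi : measurable_fun setT (fun z : path * S => (z.1, Q z)).
  exact: measurable_fun_pair.
have mE D : measurable D -> m D = mul ((fun z : path * S => (z.1, Q z)) @^-1` D).
  by move=> mD; exact: QE.
have mcoord j : measurable_fun setT
    (fun z : path * borel 'rV[R]_n => ((z.2 : 'rV[R]_n) ord0 j)%:E).
  apply/measurable_EFinP.
  exact: measurableT_comp (measurable_mx_coord ord0 j) measurable_snd.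
have intm j : m.-integrable setT
    (fun z : path * borel 'rV[R]_n => ((z.2 : 'rV[R]_n) ord0 j)%:E).
  by apply/(integrable_law mu mX (mcoord j)); exact: state_integrable.
have intQ j : mul.-integrable setT (fun z => ((Q z : 'rV[R]_n) ord0 j)%:E).
  exact/(integrable_same_law mPsi mE (mcoord j)).
exists dS, S, lam, Q; split => //.
  move=> C mC.
  have mC' : measurable [set z : path * borel 'rV[R]_n | C (set_state t.+1 z.1 z.2)].
    by rewrite -[X in measurable X]setTI; exact: measurable_set_state.
  transitivity (m [set z | C (set_state t.+1 z.1 z.2)]); last exact: mE.
  apply: (congr1 mu); apply/seteqP; split => w /=; by rewrite stopS.
move=> j.
(* Both sides have the same integral over every measurable [B]: Fubini and the joint law bring the
   left side to the state at time [t.+1], and the martingale property moves it back to time [t]. *)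
have : ae_eq (mu_ t) setT (fun e => \int[lam]_s ((Q (e, s) : 'rV[R]_n) ord0 j)%:E)%E
    (fun e => (state e t ord0 j)%:E).
  apply: integral_ae_eq => //.
  - exact: (integrable_fubini_F (intQ j)).
  - by apply/measurable_EFinP; exact: measurable_state_coord.
  move=> B _ mB.
  have mBT : measurable (B `*` [set: borel 'rV[R]_n]) by exact: measurableX.
  have mBS : measurable (B `*` [set: S]) by exact: measurableX.
  have ints : (mu_ t).-integrable setT (fun e => (state e t ord0 j)%:E).
    apply/(integrable_law mu (@measurable_stop R n T t)) => //.
      by apply/measurable_EFinP; exact: measurable_state_coord.
    rewrite (_ : _ \o _ = fun w => (state w t ord0 j)%:E).
      exact: state_integrable (ltnW tT).
    by apply/funext => w /=; rewrite state_stop// ltnW.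
  transitivity (\int[mul]_(z in B `*` setT) ((Q z : 'rV[R]_n) ord0 j)%:E)%E.
    rewrite [RHS]integral_mkcond -integral12_prod_meas1; last first.
      by apply/(integrable_mkcond _ mBS); exact: integrableS (intQ j).
    rewrite integral_mkcond; apply: eq_integral => e _; rewrite /fubini_F patchE.
    case: ifPn => eB.
      by apply: eq_integral => s _; rewrite patchE in_setX/= eB in_setT.
    rewrite integral0_eq// => s _.
    by rewrite patchE in_setX/= (negbTE eB).
  transitivity (\int[m]_(z in B `*` setT) ((z.2 : 'rV[R]_n) ord0 j)%:E)%E.
    by rewrite (integral_same_law mPsi mE mBT (intm j)); congr integral.
  transitivity (\int[mu]_(w in stop t @^-1` B) (state w t.+1 ord0 j)%:E)%E.
    rewrite (integral_law mBT (intm j)); congr integral.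
    by apply/seteqP; split => w // [].
  rewrite martingale_step// (integral_law mB ints).
  by apply: eq_integral => w _; rewrite state_stop// ltnW.
by apply: filterS => e; exact.
Qed.

(** What the induction retains of the conditional expectation is its mean and the existence, from
    almost every stopped path, of a tree realizing its value. *)
Let reachable t (y : 'rV[R]_k) := exists g : path -> 'rV[R]_k,
  [/\ forall j, measurable_fun setT (fun w => g w ord0 j),
      forall j, (mu_ t).-integrable setT (fun w => (g w ord0 j)%:E),
      forall j, (\int[mu_ t]_w (g w ord0 j)%:E = (y ord0 j)%:E)%E &
      {ae mu_ t, forall w, tree A f (T - t) t w (g w)}].

Let reachable_step t y : (t < T)%N -> reachable t.+1 y -> reachable t y.
Proof.
move=> tT [g [mg intg gy aeg]].
have [dS [S [lam [Q [mQ lawQ intQ Qstate]]]]] := noise_exists tT.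
pose mul : probability (path * S)%type R := (mu_ t \x lam)%E.
pose next (z : path * S) : path := set_state t.+1 z.1 (Q z).
have mnext : measurable_fun setT next.
  apply: (measurableT_comp (@measurable_set_state R n T t.+1)
    (g := fun z => (z.1, Q z))).
  exact: measurable_fun_pair.
have nextE D : measurable D -> mu_ t.+1 D = mul (next @^-1` D).
  by move=> mD; exact: lawQ.
have mgE j : measurable_fun setT (fun w => (g w ord0 j)%:E).
  exact/measurable_EFinP.
have inth j : mul.-integrable setT (fun z => (g (next z) ord0 j)%:E).
  exact/(integrable_same_law mnext nextE (mgE j)).
(* Averaging over the independent noise is conditioning on the path up to time [t]. *)
pose F j := fubini_F lam (fun z => (g (next z) ord0 j)%:E).
have intF j : (mu_ t).-integrable setT (F j) by exact: integrable_fubini_F (inth j).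
have FE j : (\int[mu_ t]_e F j e = (y ord0 j)%:E)%E.
  rewrite -gy (integral_same_law mnext nextE measurableT (intg j)).
  exact: integral12_prod_meas1 (inth j).
have finF j := integrable_fine (intF j).
exists (fun e => \row_j fine (F j e)); split.
- move=> j; under eq_fun do rewrite mxE.
  by apply: measurableT_comp => //; exact: measurable_int (intF j).
- by move=> j; under eq_fun do rewrite mxE; exact: (finF j).1.
- by move=> j; under eq_integral do rewrite mxE; rewrite (finF j).2.
have ae1 : {ae mu_ t, forall e, forall j,
    lam.-integrable setT (fun s => (g (next (e, s)) ord0 j)%:E)}.
  by apply: ae_forall_countable => j; exact: ae_integrable1 (inth j).
have ae2 : {ae mu_ t, forall e, forall j,
    lam.-integrable setT (fun s => ((Q (e, s) : 'rV[R]_n) ord0 j)%:E)}.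
  by apply: ae_forall_countable => j; exact: ae_integrable1 (intQ j).
have ae3 : {ae mu_ t, forall e, forall j,
    (\int[lam]_s ((Q (e, s) : 'rV[R]_n) ord0 j)%:E = (state e t ord0 j)%:E)%E}.
  by apply: ae_forall_countable => j; exact: Qstate.
have ae4 := ae_section (ae_same_law mnext nextE aeg).
(* A path [e] of a set of full measure is now fixed, and the branches are chosen for it alone. *)
apply: filterS (filterI ae1 (filterI ae2 (filterI ae3 ae4))) => e [e1 [e2 [e3 e4]]].
pose V s : 'rV[R]_(n + k) := row_mx (Q (e, s)) (g (next (e, s))).
(* [barycenter] indexes coordinates by natural numbers; the default 0 fills the indices from [n + k]
   on. *)
pose Y (j : nat) s := oapp (V s ord0) 0 (insub j).
have YE (j : 'I_(n + k)) s : Y j s = V s ord0 j by rewrite /Y valK.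
have intY (j : 'I_(n + k)) : lam.-integrable setT (fun s => (V s ord0 j)%:E).
  rewrite /V; case: (split_ordP j) => i ->.
    by under eq_fun do rewrite row_mxEl; exact: e2.
  by under eq_fun do rewrite row_mxEr; exact: e1.
have [|c [s [c0 c1 Ps cY]]] := @barycenter R (n + k) _ S lam _ Y _ e4.
  move=> j jnk; have := intY (Ordinal jnk).
  by under eq_fun do rewrite -YE.
have cV (j : 'I_(n + k)) :
    (\int[lam]_s (V s ord0 j)%:E = (\sum_i c i * V (s i) ord0 j)%:E)%E.
  have := cY j (ltn_ord j); under eq_integral do rewrite YE.
  by move=> ->; congr EFin; apply: eq_bigr => i _; rewrite YE.
rewrite -(subnSK tT) /=.
exists c, (fun i => Q (e, s i)), (fun i => g (next (e, s i))); split => //.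
- apply/rowP => j; apply: EFin_inj; rewrite -e3.
  transitivity (\int[lam]_s (V s ord0 (lshift k j))%:E)%E; last first.
    by apply: eq_integral => s' _; rewrite /V row_mxEl.
  rewrite cV summxE; congr EFin; apply: eq_bigr => i _.
  by rewrite /V row_mxEl mxE.
- apply/rowP => j; rewrite [RHS]mxE /F /fubini_F.
  transitivity (fine (\int[lam]_s (V s ord0 (rshift n j))%:E)%E); last first.
    by congr fine; apply: eq_integral => s' _; rewrite /V row_mxEr.
  rewrite cV/= summxE; apply: eq_bigr => i _.
  by rewrite /V row_mxEr mxE.
Qed.

Lemma tree_exists (y : 'rV[R]_k) (g : path -> 'rV[R]_k) :
  measurable_fun setT (g : path -> borel 'rV[R]_k) ->
  (forall j, mu.-integrable setT (fun w => (g w ord0 j)%:E)) ->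
  (forall j, (\int[mu]_w (g w ord0 j)%:E = (y ord0 j)%:E)%E) ->
  {ae mu, forall w, A w} -> {ae mu, forall w, f w = g w} ->
  exists w, state w 0 = x0 /\ tree A f T 0 w y.
Proof.
move=> mg intg gy aeA aefg; have aeg := filterI aeA aefg.
have mgj j : measurable_fun setT (fun w => g w ord0 j).
  exact: measurableT_comp (measurable_mx_coord ord0 j) mg.
have mgE j : measurable_fun setT (fun w => (g w ord0 j)%:E).
  exact/measurable_EFinP.
have stopT : stop T = id :> (path -> path) by apply/funext => w; exact: stop_max.
have muT B : mu_ T B = mu B.
  by rewrite -[LHS]/(mu (stop T @^-1` B)) stopT.
have intgT j : (mu_ T).-integrable setT (fun w => (g w ord0 j)%:E).
  by apply/(integrable_law mu _ (mgE j)); rewrite stopT; exact: intg.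
(* At time [T] a tree is a leaf: membership in [A] and the equality of [f] with its Borel version,
   both almost sure. *)
have reachT : reachable T y.
  exists g; split => // [j|].
    by rewrite (integral_law measurableT (intgT j)) stopT; exact: gy.
  have [N [mN N0 AN]] := aeg; exists N; split => //.
    by rewrite muT.
  by rewrite subnn.
have reach t : (t <= T)%N -> reachable (T - t) y.
  elim: t => [|t IH] tT; first by rewrite subn0.
  apply: reachable_step; first by rewrite ltn_subrL (leq_trans _ tT).
  by rewrite -subSn// subSS; exact: IH (ltnW tT).
have := reach T (leqnn T); rewrite subnn => -[h [mh inth hy aeh]].
have aeh' : {ae mu, forall w, tree A f T 0 (stop 0 w) (h (stop 0 w))}.
  by rewrite subn0 in aeh; exact: (ae_same_law (@measurable_stop R n T 0) _ aeh).
(* Stopped at time 0, almost every path is this deterministic one. The mean [y] is therefore the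
   value [h e], and an almost sure tree is a tree from [e]. *)
pose e : path := \matrix_(i, j) if i == 0 :> nat then x0 ord0 j else 0.
have aee : {ae mu, forall w, stop 0 w = e}.
  apply: filterS (mu_martingale.2) => w wx.
  apply/matrixP => i j; rewrite !mxE leqn0; case: eqP => // i0.
  by rewrite -wx mxE; congr (w _ j); apply/val_inj.
have hey : h e = y.
  apply/rowP => j; apply: EFin_inj; rewrite -hy.
  rewrite (integral_law measurableT (inth j)) preimage_setT.
  rewrite (ae_eq_integral (fun=> (h e ord0 j)%:E))//.
  - by rewrite integral_cst//= probability_setT mule1.
  - apply/measurable_EFinP; exact: measurableT_comp (mh j) (@measurable_stop R n T 0).
  - by apply: filterS aee => w we _ /=; rewrite we.
exists e; split; first by apply/rowP => j; rewrite !mxE inordK.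
rewrite -hey; apply: contrapT => notree.
have : mu setT = 0%E.
  apply/(measure_negligible measurableT).
  apply: negligibleS (filterI aeh' aee) => w _ /= [+ we].
  by rewrite we.
by rewrite probability_setT => -[/eqP]; rewrite oner_eq0.
Qed.

End backward_induction.

Theorem theorem5p1 (R : realType) (k n T : nat)
    (k_gt0 : (0 < k)%N) (n_gt0 : (0 < n)%N) (T_gt0 : (0 < T)%N)
    (x0 : 'rV[R]_n) (mu : probability (paths R n T) R)
    (mu_martingale : martingale_law x0 mu)
    (A : set (completion mu)) (mA : measurable A)
    (muA : completed_measure mu A = 1%E)
    (f : paths R n T -> 'rV[R]_k)
    (f_integrable : vintegrable (completed_measure mu) f) :
  exists nu : probability (paths R n T) R,
    martingale_law x0 nu /\
    [/\ (measure_support nu #<= `I_((n + k + 1) ^ T))%card,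
        measure_support nu `<=` A,
        vintegrable (completed_measure nu) f &
        vintegral (completed_measure nu) setT f =
        vintegral (completed_measure mu) setT f].
Proof.
have [g [mg fg intg gE]] := borel_version f_integrable.
have aeA := ae_of_completed_measure1 mA muA.
set y := vintegral _ _ _ in gE *.
have [|w [w0 wy]] :=
  @tree_exists R k n T x0 mu mu_martingale A f y g mg intg _ aeA fg.
  by move=> j; rewrite gE mxE fineK//; apply: integrable_fin_num.
have [l0 [size_l lP l1 lf bal]] := tree_paths (add0n T) wy.
pose l : seq (R * paths R n T) := l0.
have l_ge0 p : p \in l -> 0 <= p.1 by move=> /lP[].
have [nu nuE] := discrete_probability_exists l_ge0 l1.
have nul : atomic l nu by move=> B _; exact: nuE.
have nucl := completed_atomic nul.
have mf : measurable_fun setT (f : completion nu -> borel 'rV[R]_k).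
  by move=> _ B mB; exact: (measurable_completion_atomic nul).
exists nu; split.
  apply: (discrete_martingale_law _ nul) => [p|s sT].
    by move=> /lP[p0 _ /(_ 0%N (leqnn 0)) ->]; rewrite w0.
  exact: bal.
have supp := atomic_support nul.
split.
(* The list may repeat a path, so its length bounds the support through the surjection [nth] from
   indices to atoms. *)
- apply: (card_le_trans (subset_card_le supp)).
  rewrite -size_l -(size_map snd); set s := map snd l.
  apply: card_le_trans (card_image_le (nth point s) `I_(size s)).
  apply: subset_card_le => v vs; exists (index v s) => /=; last exact: nth_index.
  by rewrite index_mem.
- by move=> v /supp/= /mapP[p /lP[_ Ap _] ->].
- exact: (@vintegrable_atomic _ (completion nu) _ _ l l_ge0 nucl _ _ mf).
- rewrite (@vintegral_atomic _ (completion nu) _ _ l l_ge0 nucl)// -lf; apply: eq_bigr => p _.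
  by rewrite indicT mulr1.
Qed.
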